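(* Let $p_1,\dots,p_r$ be tropical polynomials on $\mathbb{R}^n$ and let $X=V(p_1)\cap_{stb}\cdots\cap_{stb}V(p_r)\subset\mathbb{R}^n$ be a transverse tropical complete intersection of codimension $r$. Let $L\subset\mathbb{R}^n$ be a generic tropical affine linear space of codimension $n-r$, and let $x\in X\cap_{stb}L$ be an isolated stable intersection point. For every $i=1,\dots,r$ let $\sigma_i$ be the facet of $V(p_i)$ containing $x$ and let $n_i\in\mathbb{Z}^n$ be its primitive integer normal vector. Similarly, let $\tau_1,\dots,\tau_{n-r}$ be the facets of (the tropical hyperplanes defining) $L$ meeting at $x$, and let $m_1,\dots,m_{n-r}\in\mathbb{Z}^n$ be their primitive integer normal vectors. Let $$C=F_1+\cdots+F_r+G_1+\cdots+G_{n-r}$$ be the mixed cell in the dual mixed subdivision corresponding to $x$, where $F_i$ is the edge dual to $\sigma_i$ and $G_j$ is the edge dual to $\tau_j$. Then $$m(x)=\operatorname{Vol}_{\mathbb{Z}}(C).$$ Equivalently, $$m(x)=\left|\det(n_1,\dots,n_r,m_1,\dots,m_{n-r})\right|.$$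
   Context: Tropical polynomials and duality. A tropical polynomial is $p_i(x)=\max_{\alpha\in\mathcal{M}_i}(\langle x,\alpha\rangle+c_{i,\alpha})$ with $\mathcal{M}_i\subset\mathbb{Z}^n$ finite and $c_{i,\alpha}\in\mathbb{R}$; its tropical hypersurface $V(p_i)$ is the set of $x\in\mathbb{R}^n$ where the maximum is attained at least twice, and its Newton polytope is $\Delta_i=\operatorname{conv}(\mathcal{M}_i)$. The coefficients induce a regular subdivision of $\Delta_i$ dual to $V(p_i)$; a facet (maximal cell) $\sigma_i$ of $V(p_i)$ is dual to an edge $F_i=[u_i,v_i]$, $u_i,v_i\in\mathbb{Z}^n$, of this subdivision, and $\sigma_i$ lies in a hyperplane $\langle v_i-u_i,x\rangle=\lambda_i$. The facet has weight the lattice length of $F_i$. The paper's convention is that for the facets considered the primitive normal vector is $n_i=v_i-u_i$, i.e. the dual edges are primitive (facets of weight $1$); similarly $G_j=[w_j,w_j+m_j]$. Tropical affine linear space. $L$ of codimension $n-r$ is a stable intersection of $n-r$ tropical hyperplanes, i.e. tropical hypersurfaces with Newton polytope the unimodular simplex $\Sigma=\operatorname{conv}(0,e_1,\dots,e_n)$; $\tau_j$ is the facet of the $j$-th hyperplane containing $x$. The dual mixed subdivision is the regular mixed subdivision of $\Delta_1+\cdots+\Delta_r+\Sigma+\cdots+\Sigma$ ($n-r$ copies of $\Sigma$) induced by the coefficients. Transversality. The intersections are transverse: each intersection point lies in the relative interior of one facet of each hypersurface involved, and the normal vectors of these facets are linearly independent. Stable intersection. Let $N=\mathbb{Z}^n$,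 $N_{\mathbb{R}}=\mathbb{R}^n$. A tropical cycle is a pure weighted balanced rational polyhedral complex (integer weights on maximal cells). For a tropical cycle $A$ and $\omega\in A$, $\operatorname{link}_\omega(A)=\{u:\omega+\varepsilon u\in A\text{ for all sufficiently small }\varepsilon>0\}$. The stable intersection $A\cap_{stb}B$ has support $\{\omega:\operatorname{supp}(\operatorname{link}_\omega(A)-\operatorname{link}_\omega(B))=N_{\mathbb{R}}\}$, where $-$ is the Minkowski difference $P-Q=P+(-Q)$. A face $\gamma$ of codimension $\operatorname{codim}A+\operatorname{codim}B$ gets multiplicity $$\sum_{\sigma,\tau}\operatorname{mult}_A(\sigma)\operatorname{mult}_B(\tau)\,[N:N_\sigma+N_\tau],$$ the sum over facets $\sigma\subset\operatorname{link}_\gamma(A)$, $\tau\subset\operatorname{link}_\gamma(B)$ with $v\in\sigma-\tau$, for a fixed generic $v\in N_{\mathbb{R}}$, where $N_\sigma=\operatorname{span}(\sigma-\sigma)\cap N$ and likewise $N_\tau$. Stable intersections of several cycles are defined recursively: $A_1\cap_{stb}\cdots\cap_{stb}A_k=(A_1\cap_{stb}\cdots\cap_{stb}A_{k-1})\cap_{stb}A_k$. For an isolated point $x\in X\cap_{stb}L$, $m(x)$ is its multiplicity. $\operatorname{Vol}_{\mathbb{Z}}$ is the lattice volume on $\mathbb{R}^n$ normalized so that the parallelotope spanned by $a_1,\dots,a_n\in\mathbb{Z}^n$ has volume $|\det(a_1,\dots,a_n)|$. *)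

(* Defs.v *)
From mathcomp Require Import all_boot all_order all_algebra finmap.
From mathcomp Require Import all_classical all_reals all_analysis.

Set Implicit Arguments.
Unset Strict Implicit.
Unset Printing Implicit Defensive.

Import Order.TTheory GRing.Theory Num.Theory.
Import numFieldNormedType.Exports.

Local Open Scope classical_set_scope.
Local Open Scope ring_scope.

Section Lattice.
Variables (R : realType) (n : nat).

Definition to_real (z : 'rV[int]_n) : 'rV[R]_n := map_mx intr z.

Definition pairing (x : 'rV[R]_n) (z : 'rV[int]_n) : R :=
  \sum_(i < n) x 0 i * (z 0 i)%:~R.

Definition content (z : 'rV[int]_n) : nat := \big[gcdn/0%N]_(i < n) absz (z 0 i).

Definition set_add (T : zmodType) (P Q : set T) : set T :=
  [set a + b | a in P & b in Q].

Definition set_sub (T : zmodType) (P Q : set T) : set T :=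
  [set a - b | a in P & b in Q].

(* [N : H] for a subgroup H of N = Z^n: the number of cosets of H; fset_set
   of an infinite set is empty, so the value is 0 when the index is infinite. *)
Definition lattice_index (H : set 'rV[int]_n) : nat :=
  #|` fset_set (range (fun a : 'rV[int]_n => [set a + h | h in H]))|.

End Lattice.

Section Convexity.
Variables (R : realType) (n : nat).
Implicit Types (S : set 'rV[R]_n) (y w : 'rV[R]_n).

Definition lin_span S : set 'rV[R]_n :=
  [set y | exists (k : nat) (a : 'I_k -> R) (s : 'I_k -> 'rV[R]_n),
     (forall i, S (s i)) /\ y = \sum_(i < k) a i *: s i].

Definition aff_hull S : set 'rV[R]_n :=
  [set y | exists (k : nat) (a : 'I_k -> R) (s : 'I_k -> 'rV[R]_n),
     [/\ forall i, S (s i), \sum_(i < k) a i = 1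
       & y = \sum_(i < k) a i *: s i]].

Definition conv_hull S : set 'rV[R]_n :=
  [set y | exists (k : nat) (a : 'I_k -> R) (s : 'I_k -> 'rV[R]_n),
     [/\ forall i, S (s i), forall i, 0 <= a i, \sum_(i < k) a i = 1
       & y = \sum_(i < k) a i *: s i]].

Definition relint S : set 'rV[R]_n :=
  [set y | S y /\ \forall z \near y, aff_hull S z -> S z].

Definition segment (u v : 'rV[int]_n) : set 'rV[R]_n :=
  conv_hull [set to_real R u; to_real R v].

(* The lattice length of F when F = [u, v] with u, v in Z^n (0 if F is not
   such a segment). *)
Definition lattice_length (F : set 'rV[R]_n) : nat :=
  get [set l : nat | exists u v : 'rV[int]_n,
         F = segment u v /\ l = content (v - u)].

Definition link w S : set 'rV[R]_n :=
  [set u | \forall e \near 0^'+, S (w + e *: u)].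

Definition sublattice S : set 'rV[int]_n :=
  [set z | lin_span (set_sub S S) (to_real R z)].

End Convexity.

(* A weighted polyhedral complex: its support, its (nonempty, closed) cells of
   all dimensions, and a weight, of which only the values on the maximal cells
   are meaningful. The complexes used below (R^n, tropical hypersurfaces and
   their stable intersections) are pure, rational and balanced. *)
Record complex (R : realType) (n : nat) := Complex {
  supp : set 'rV[R]_n;
  cells : set (set 'rV[R]_n);
  weight : set 'rV[R]_n -> int }.

Section StableIntersection.
Variables (R : realType) (n : nat).
Implicit Types (A B : complex R n) (g : set 'rV[R]_n) (v w : 'rV[R]_n).

Definition facet A : set (set 'rV[R]_n) :=
  [set s | cells A s /\ forall t, cells A t -> s `<=` t -> t = s].

Definition stable_supp A B : set 'rV[R]_n :=
  [set w | set_sub (link w (supp A)) (link w (supp B)) = setT].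

(* v avoids all the cones link_w(s) - link_w(t) that are not of full
   dimension; the cells s and t need not be maximal. *)
Definition generic_direction A B w v : Prop :=
  forall s t, cells A s -> cells B t ->
    let D := set_sub (link w s) (link w t) in
    lin_span D <> setT -> ~ D v.

(* The multiplicity of the cell g in the stable intersection. The facets of
   link_g(A) are the cones link_w(s), with w in the relative interior of g and
   s a facet of A containing g; they inherit their weights and lattices
   from s. *)
Definition stable_weight A B g : int :=
  let w := get (relint g) in
  let v := get (generic_direction A B w) in
  \sum_(st \in [set st : set 'rV[R]_n * set 'rV[R]_n |
      [/\ facet A st.1, g `<=` st.1, facet B st.2, g `<=` st.2
        & set_sub (link w st.1) (link w st.2) v]])
    weight A st.1 * weight B st.2 *
    (lattice_index (set_add (sublattice st.1) (sublattice st.2)))%:Z.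

(* The support is given by the condition on links. It is a union of cells of
   the common refinement of A and B, and these cells are the cells of the
   stable intersection; the condition on links is constant on the relative
   interior of each cell of the common refinement. *)
Definition stable_inter A B : complex R n :=
  {| supp := stable_supp A B;
     cells := [set g | [/\ g !=set0,
       exists s t, [/\ cells A s, cells B t & g = s `&` t]
       & relint g `<=` stable_supp A B]];
     weight := stable_weight A B |}.

Definition whole_space : complex R n :=
  {| supp := setT; cells := [set setT]; weight := fun=> 1 |}.

(* Iterated from the left, starting with the first complex; an empty intersection is R^n. *)
Definition stable_inters (s : seq (complex R n)) : complex R n :=
  if s is A :: s' then foldl stable_inter A s' else whole_space.

End StableIntersection.

Record tpoly (R : realType) (n : nat) := TPoly {
  exponents : {fset 'rV[int]_n};
  exponents_neq0 : exponents != fset0;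
  coef : 'rV[int]_n -> R }.

Section Tropical.
Variables (R : realType) (n : nat).
Implicit Types (p : tpoly R n) (x : 'rV[R]_n) (a b : 'rV[int]_n).

Definition tterm p a x : R := pairing x a + coef p a.

Definition attains p x a : Prop :=
  a \in exponents p /\
  forall b, b \in exponents p -> tterm p b x <= tterm p a x.

Definition newton p : set 'rV[R]_n :=
  conv_hull [set to_real R a | a in [set` exponents p]].

Definition dual_cell p (g : set 'rV[R]_n) : set 'rV[R]_n :=
  conv_hull [set to_real R a | a in [set a | forall x, g x -> attains p x a]].

Definition hypersurface p : complex R n :=
  {| supp := [set x | exists a b, [/\ a != b, attains p x a & attains p x b]];
     cells := [set g | g !=set0 /\ exists a b (S : set 'rV[int]_n),
       [/\ a != b, S a, S b
         & g = [set x | forall c, S c -> attains p x c]]];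
     weight := fun g => (lattice_length (dual_cell p g))%:Z |}.

Definition unimodular_simplex : set 'rV[R]_n :=
  conv_hull ([set 0] `|` range (fun i : 'I_n => delta_mx 0 i)).

Definition tropical_hyperplane p : Prop := newton p = unimodular_simplex.

(* For a facet g of a hypersurface this determines nu up to sign. *)
Definition primitive_normal (g : set 'rV[R]_n) (nu : 'rV[int]_n) : Prop :=
  content nu = 1%N /\ forall y z, g y -> g z -> pairing (y - z) nu = 0.

Definition transverse_at (m : nat) (f : 'I_m -> tpoly R n) x : Prop :=
  exists (s : 'I_m -> set 'rV[R]_n) (nu : 'I_m -> 'rV[int]_n),
    [/\ forall i, facet (hypersurface (f i)) (s i) /\ relint (s i) x,
        forall i, primitive_normal (s i) (nu i)
      & row_free (\matrix_i to_real R (nu i))].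

Definition complete_inter (m : nat) (f : 'I_m -> tpoly R n) : complex R n :=
  stable_inters [seq hypersurface (f i) | i <- enum 'I_m].

(* When the intersection has positive dimension, the transversality condition
   can only be required at generic points, i.e. in the relative interior of its
   maximal cells. *)
Definition transverse_complete_inter (m : nat) (f : 'I_m -> tpoly R n) : Prop :=
  forall g y, facet (complete_inter f) g -> relint g y -> transverse_at f y.

End Tropical.

(* L = complete_inter q is generic with respect to X = complete_inter p: at
   every point of their stable intersection, all the hypersurfaces involved
   meet transversely. *)
Definition generic_linear_space (R : realType) (n r s : nat)
    (p : 'I_r -> tpoly R n) (q : 'I_s -> tpoly R n) : Prop :=
  forall y, supp (stable_inter (complete_inter p) (complete_inter q)) y ->
    transverse_at
      (fun k => match fintype.split k with inl i => p i | inr j => q j end) y.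

Notation borel R n := (g_sigma_algebraType (@open 'rV[R]_n)).

Section Volume.
Variables (R : realType) (n : nat).

Definition parallelotope (A : 'M[int]_n) : set 'rV[R]_n :=
  [set y | exists t : 'I_n -> R, (forall i, 0 <= t i <= 1) /\
     y = \sum_(i < n) t i *: to_real R (row i A)].

(* Lebesgue measure on the Borel sets of R^n, as the translation-invariant
   measure for which integral parallelotopes have volume |det|. *)
Definition lattice_volume (vol : {measure set (borel R n) -> \bar R}) : Prop :=
  (forall (D : set 'rV[R]_n) (a : 'rV[R]_n), measurable (D : set (borel R n)) ->
     vol [set a + y | y in D] = vol D) /\
  (forall A : 'M[int]_n, vol (parallelotope A) = (`|\det A|%:~R)%:E).

Definition minkowski_sum (m : nat) (F : 'I_m -> set 'rV[R]_n) : set 'rV[R]_n :=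
  [set y | exists f : 'I_m -> 'rV[R]_n,
     (forall i, F i (f i)) /\ y = \sum_(i < m) f i].

End Volume.

(* Main.v *)
Require Import Defs.
From mathcomp Require Import all_boot all_order all_algebra finmap.
From mathcomp Require Import all_classical all_reals all_analysis.
From mathcomp Require Import ring lra zify.
Set Implicit Arguments.
Unset Strict Implicit.
Unset Printing Implicit Defensive.
Import Order.TTheory GRing.Theory Num.Theory.
Import numFieldNormedType.Exports.
Local Open Scope classical_set_scope.
Local Open Scope ring_scope.

(** Because x is a transverse point, every complex involved looks, around x,
    like a single linear space, and the multiplicity is then pure lattice
    arithmetic.

    A facet of a hypersurface V(p) having x in its relative interior is dual to
    an edge ([facet_edge]): were the exponents of p that are maximal at x not
    collinear, moving away from x along a suitable direction would keep two of
    them maximal and lose a third, so that the facet would lie in a larger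
    cell. When these exponents lie on a line of direction nu, all cells of V(p)
    through x coincide with one convex cell, of direction the orthogonal of nu
    ([sole_cell_at], [direction_cell_at]). Having exactly one cell at the
    points of its relative interior is a property ([sole_cell]) that passes to
    the intersection of two cells in complementary position
    ([sole_cell_stable_inter]); the sum defining the weight of a stable
    intersection has then a single term, whatever the generic vector
    ([stable_inter_weight]).

    Hence, since the hypersurfaces have weight 1 at x, adding them one by one
    gives X as weight at x the product of the indices of K_k + ker nu_k in
    Z^n, where K_k is the common kernel of the normals preceding nu_k. In a
    basis of Z^n for which the matrix of the normals becomes lower triangular,
    these indices are the absolute values of the diagonal entries
    ([lattice_index_step]), so that the weight of X at x is |det T| for the
    triangular block T ([complete_inter_cell]); likewise the weight of L is
    |det T'|. The last stable intersection contributes the index of ker (nu) +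
    ker (mu), and comparing the determinants of the full matrix in three bases
    gives
    |det (nu, mu)| = |det T| |det T'| [Z^n : ker (nu) + ker (mu)]
    ([absz_det_col_mx]).

    Finally each dual edge is a segment [a, a + nu_i]: for the p_i because its
    lattice length is 1, for the q_j because no three vertices of the
    unimodular simplex are collinear and its edges are primitive. The mixed
    cell is thus a translate of the parallelotope spanned by the normals
    ([volume_mixed_cell]). *)

(** * Indices of sublattices of the integer lattice *)

(** Hermite reduction by column operations: the Smith normal form of the first row
    clears that row outside its first entry, and the induction hypothesis treats
    the block below. *)
Lemma exists_lower_trig m n (A : 'M[int]_(m, n)) :
  exists2 U : 'M[int]_n, U \in unitmx & is_trig_mx (A *m U).
Proof.
elim: m => [|m IHm] in n A *.
  by exists 1%:M; rewrite ?unitmx1//; apply/is_trig_mxP => -[].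
case: n A => [|n] A.
  by exists 1%:M; rewrite ?unitmx1//; apply/is_trig_mxP => ? [].
have [L _ [R0 R0u [d _ AE]]] := int_Smith_normal_form (@usubmx _ 1 m _ A).
pose A' : 'M[int]_(1 + m, 1 + n) := A *m invmx R0.
have [U Uu tU] := IHm n (drsubmx A').
pose V : 'M[int]_(1 + n) := block_mx 1%:M 0 0 U.
exists (invmx R0 *m V).
  rewrite unitmx_mul unitmx_inv R0u/= unitmxE.
  by rewrite -[\det _]/(\det V) det_ublock det1 mul1r -unitmxE.
suff uA'0 : ursubmx A' = 0.
  have -> : A *m (invmx R0 *m V) = block_mx (ulsubmx A') 0 (dlsubmx A')
      (drsubmx A' *m U) :> 'M[int]_(1 + m, 1 + n).
    rewrite mulmxA -[A *m _]/A' -{1}(submxK A') uA'0 /V.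
    apply: etrans; first exact: (mulmx_block (ulsubmx A') 0 (dlsubmx A')).
    by rewrite !mulmx1 !mulmx0 !mul0mx !addr0 !add0r.
  apply: etrans; first exact: (@is_trig_block_mx _ 1 m 1 n).
  by rewrite eqxx mx11_is_trig.
have uA' : usubmx A' = L *m \matrix_(i, j) (d`_i *+ (i == j :> nat)).
  by rewrite -mul_usub_mx AE mulmxK.
apply/matrixP => i j; rewrite mxE uA' mxE [RHS]mxE big1// => k _.
by rewrite !mxE (ord1 k) mulr0.
Qed.

Lemma content0 n : Defs.content (0 : 'rV[int]_n) = 0%N.
Proof. by rewrite /Defs.content big1// => i _; rewrite mxE. Qed.

Lemma contentZ n (c : int) (z : 'rV[int]_n) : Defs.content (c *: z) = (absz c * Defs.content z)%N.
Proof.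
rewrite /Defs.content big_endo ?muln0// => [|x y]; last exact: muln_gcdr.
by apply: eq_bigr => i _; rewrite mxE abszM.
Qed.

Lemma content_dvd n (z : 'rV[int]_n) i : (Defs.content z %| absz (z 0%R i))%N.
Proof. by rewrite /Defs.content (bigD1 i)//= dvdn_gcdl. Qed.

(** Bezout: once column operations have reduced nu to a single entry d, this d
    divides all the coordinates of nu, so it is a unit. *)
Lemma primitive_unimodular n (nu : 'rV[int]_n) : Defs.content nu = 1%N ->
  exists z : 'rV[int]_n, nu *m z^T = 1%:M.
Proof.
case: n nu => [|n] nu nu1; first by rewrite /Defs.content big_ord0 in nu1.
have [U Uu /is_trig_mxP tU] := exists_lower_trig nu.
pose d := (nu *m U) 0 0.
have nuE : nu = d *: row 0 (invmx U).
  apply/rowP => j; rewrite -{1}[nu](mulmxK Uu) mxE (bigD1 0)//= big1.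
    by rewrite addr0 [RHS]mxE; congr (_ * _); rewrite mxE.
  by move=> i i0; rewrite tU ?mul0r// lt0n.
have d1 : absz d = 1%N.
  apply/eqP; rewrite -dvdn1 -nu1 nuE contentZ dvdn_mulr//.
exists (d *: (col 0 U)^T).
rewrite linearZ/= trmxK -scalemxAr; apply/matrixP => i j.
rewrite !ord1 !mxE.
have -> : \sum_k nu 0 k * col 0 U k 0 = d.
  by rewrite /d mxE; apply: eq_bigr => k _; rewrite mxE.
by have [->|->] : d = 1 \/ d = -1 by lia.
Qed.

(** The rows of Q and of B together form a basis of Z^n adapted to A: B spans the
    kernel of A, and A becomes triangular on Q. That they form a basis is expressed
    by the coordinate maps C1 and C2 instead of the invertibility of a block
    matrix, because both orders of the two blocks occur below. *)
Lemma exists_lattice_splitting a b n (A : 'M[int]_(a, n)) : n = (a + b)%N ->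
  exists (Q : 'M[int]_(a, n)) (B : 'M[int]_(b, n))
    (C1 : 'M[int]_(n, a)) (C2 : 'M[int]_(n, b)),
  [/\ C1 *m Q + C2 *m B = 1%:M, A *m B^T = 0 & is_trig_mx (A *m Q^T)].
Proof.
move=> nE; case: _ / (esym nE) A => A {nE}.
have [U Uu tU] := exists_lower_trig A.
exists (lsubmx U)^T, (rsubmx U)^T, (lsubmx (invmx U)^T), (rsubmx (invmx U)^T).
rewrite !trmxK; split.
- by rewrite -mul_row_col -tr_row_mx !hsubmxK -trmx_mul mulmxV// trmx1.
- apply/matrixP => i j; rewrite mulmx_rsub mxE [RHS]mxE.
  by move/is_trig_mxP: tU; apply; rewrite /= (leq_trans (ltn_ord i)) ?leq_addr.
- apply/is_trig_mxP => i j ij; rewrite mulmx_lsub mxE.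
  by move/is_trig_mxP: tU; apply.
Qed.

(** The cosets of H are the fibres of phi, and these are numbered by T. *)
Lemma lattice_index_quotient n (T : finType) (phi : 'rV[int]_n -> T)
    (H : set 'rV[int]_n) :
  (forall t, exists a, phi a = t) ->
  (forall a b, phi a = phi b <-> H (a - b)) -> lattice_index H = #|T|.
Proof.
move=> phis phiH; rewrite /lattice_index.
have cosetE a : [set a + h | h in H] = [set z | phi z = phi a].
  apply/seteqP; split=> [_ [h Hh <-]|z /phiH Hz] /=.
    by apply/phiH; rewrite addrC addKr.
  by exists (z - a) => //; rewrite addrC subrK.
pose fib t := [set z | phi z = t].
have fibI : injective fib.
  move=> s t st; have [a as_] := phis s.
  by have : fib s a by []; rewrite st => <-.
have -> : range (fun a : 'rV[int]_n => [set a + h | h in H]) =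
    [set` [fset fib t | t in T]%fset].
  apply/seteqP; split=> [_ [a _ <-]|_ /imfsetP[t _ ->]].
    by rewrite cosetE; apply/imfsetP; exists (phi a).
  by have [a <-] := phis t; exists a; rewrite // cosetE.
by rewrite set_fsetK card_imfset //= cardE.
Qed.

Lemma lattice_index_setT n : lattice_index [set: 'rV[int]_n] = 1%N.
Proof.
rewrite (lattice_index_quotient (phi := fun=> tt)) ?card_unit//.
by case; exists 0.
Qed.

Lemma absz_det_unitmx n (U : 'M[int]_n) : U \in unitmx -> absz (\det U) = 1%N.
Proof. by rewrite unitmxE => /orP[] /eqP ->. Qed.

(** Write P = L D R with D diagonal and L, R unimodular: in the basis formed by the
    rows of R, the row lattice of P is the product of the ideals d_i Z, so reducing
    each coordinate modulo d_i identifies the quotient. *)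
Lemma lattice_index_rowspan n (P : 'M[int]_n) : \det P != 0 ->
  lattice_index [set z : 'rV[int]_n | exists y, z = y *m P] = absz (\det P).
Proof.
have [L Lu [R0 R0u [d _ PE]]] := int_Smith_normal_form P.
set D := (\matrix_(i, j) _) in PE.
have DE : D = diag_mx (\row_i d`_i).
  by apply/matrixP => i j; rewrite !mxE -val_eqE; case: eqP => // ->.
pose e (i : 'I_n) := absz d`_i.
have detP : absz (\det P) = (\prod_(i < n) e i)%N.
  rewrite PE !det_mulmx !abszM (absz_det_unitmx Lu) (absz_det_unitmx R0u).
  rewrite mul1n muln1 DE det_diag.
  by rewrite (big_morph absz abszM erefl); apply: eq_bigr => i _; rewrite mxE.
rewrite -absz_eq0 detP -lt0n => prod_gt0.
have d_gt0 (i : 'I_n) : (0 < e i)%N.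
  by move: prod_gt0; rewrite (bigD1 i)//= muln_gt0 => /andP[].
have d_neq0 (i : 'I_n) : d`_i != 0 by rewrite -absz_gt0 -/(e i).
pose T := {dffun forall i : 'I_n, 'I_(e i).-1.+1}.
pose c (z : 'rV[int]_n) (i : 'I_n) : int := (z *m invmx R0) 0 i.
pose phi (z : 'rV[int]_n) : T :=
  [ffun i : 'I_n => inord (absz (c z i %% d`_i)%Z)].
have cB a b i : c (a - b) i = c a i - c b i by rewrite /c mulmxBl !mxE.
have modE (x : int) (i : 'I_n) : Posz (absz (x %% d`_i)%Z) = (x %% d`_i)%Z.
  by rewrite gez0_abs// modz_ge0.
have mod_lt (x : int) (i : 'I_n) : (absz (x %% d`_i)%Z < (e i).-1.+1)%N.
  by rewrite prednK// -ltz_nat modE /e abszE ltz_mod.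
rewrite (@lattice_index_quotient _ T phi).
- rewrite card_dep_ffun foldrE big_map big_enum/=.
  by apply: eq_bigr => i _; rewrite card_ord prednK.
- move=> t; exists ((\row_i (t i : nat)%:Z) *m R0); apply/ffunP => i.
  rewrite ffunE /c mulmxK// mxE; apply: val_inj; rewrite /= inordK ?mod_lt//.
  have ti : (t i < e i)%N by rewrite (leq_trans (ltn_ord (t i)))// prednK.
  by rewrite -modz_abs modz_small ?absz_nat// ltz_nat ti.
move=> a b; split=> [ab|[y abE]].
  have dv i : (d`_i %| c (a - b)%R i)%Z.
    move/ffunP/(_ i): ab; rewrite !ffunE => /(congr1 (@nat_of_ord _)).
    rewrite !inordK ?mod_lt// => /(congr1 Posz); rewrite !modE => abi.
    by rewrite cB -eqz_mod_dvd; apply/eqP.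
  exists ((\row_i (c (a - b)%R i %/ d`_i)%Z) *m invmx L).
  rewrite PE !mulmxA mulmxKV// -[LHS](mulmxKV R0u); congr (_ *m _).
  apply/rowP => i; rewrite DE mul_mx_diag [RHS]mxE [X in _ = X * _]mxE.
  by rewrite [X in _ = _ * X]mxE divzK ?dv.
apply/ffunP => i; rewrite !ffunE; congr (inord (absz _)).
apply/eqP; rewrite eqz_mod_dvd -cB abE /c PE !mulmxA mulmxK// DE mul_mx_diag.
by rewrite !mxE dvdz_mull.
Qed.

(** Forward substitution. *)
Lemma trig_mulmx_eq0 (F : idomainType) a (T : 'M[F]_a) (y : 'cV[F]_a) k :
  is_trig_mx T -> (forall i, T i i != 0) ->
  (forall i : 'I_a, (i < k)%N -> (T *m y) i 0 = 0) ->
  forall i : 'I_a, (i < k)%N -> y i 0 = 0.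
Proof.
move=> /is_trig_mxP tT dT Ty i.
have [N] := ubnP (i : nat); elim: N i => // N IHN i iN ik.
apply/eqP; move: (Ty i ik); rewrite mxE (bigD1 i)//= big1 ?addr0.
  by move/eqP; rewrite mulf_eq0 (negPf (dT i)).
move=> j ji; have [ltij|leji] := ltnP i j; first by rewrite tT ?mul0r.
have ltji : (j < i)%N by rewrite ltn_neqAle ji.
by rewrite IHN ?mulr0// (leq_trans ltji) // (leq_trans _ ik)// ltnW.
Qed.

Section LatticeSplitting.
Variables (a b n : nat) (A : 'M[int]_(a, n)).
Variables (Q : 'M[int]_(a, n)) (B : 'M[int]_(b, n)).
Variables (C1 : 'M[int]_(n, a)) (C2 : 'M[int]_(n, b)).
Hypothesis CQB : C1 *m Q + C2 *m B = 1%:M.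
Hypothesis AB0 : A *m B^T = 0.
Hypothesis trigT : is_trig_mx (A *m Q^T).
Hypothesis diagT : forall i, (A *m Q^T) i i != 0.

Lemma splitting_coord (z : 'rV[int]_n) :
  A *m z^T = (A *m Q^T) *m (z *m C1)^T.
Proof.
rewrite -{1}[z]mulmx1 -CQB mulmxDr linearD/= mulmxDr !mulmxA !trmx_mul.
by rewrite !mulmxA AB0 !mul0mx addr0.
Qed.

Lemma splitting_kernel (z : 'rV[int]_n) :
  A *m z^T = 0 <-> exists y : 'rV[int]_b, z = y *m B.
Proof.
split=> [Az|[y ->]]; last by rewrite trmx_mul mulmxA AB0 mul0mx.
exists (z *m C2); rewrite -{1}[z]mulmx1 -CQB mulmxDr !mulmxA.
suff -> : z *m C1 = 0 by rewrite mul0mx add0r.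
apply/rowP => i; rewrite [RHS]mxE.
transitivity ((z *m C1)^T i 0); first by rewrite [RHS]mxE.
apply: (trig_mulmx_eq0 trigT diagT (k := a)) => // j _.
by rewrite -splitting_coord Az mxE.
Qed.

(** Because T = A Q^T is triangular, the k-th row of A maps the kernel of the
    preceding rows onto the ideal generated by T k k; by hypothesis it maps Z^n onto
    Z. The quotient is therefore Z modulo T k k. *)
Lemma lattice_index_step (k : 'I_a) : (exists z0 : 'rV_n, (A *m z0^T) k 0 = 1) ->
  lattice_index (set_add
    [set z : 'rV[int]_n | forall i : 'I_a, (i < k)%N -> (A *m z^T) i 0 = 0]
    [set z : 'rV[int]_n | (A *m z^T) k 0 = 0]) = absz ((A *m Q^T) k k).
Proof.
have /is_trig_mxP tT := trigT.
move=> [z0 Az0]; set d := (A *m Q^T) k k.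
pose f (z : 'rV[int]_n) : int := (A *m z^T) k 0.
have fB z w : f (z - w) = f z - f w by rewrite /f linearB/= mulmxBr !mxE.
have d_neq0 : d != 0 := diagT k.
have d_gt0 : (0 < absz d)%N by rewrite absz_gt0.
pose phi (z : 'rV[int]_n) : 'I_(absz d).-1.+1 :=
  inord (absz (f z %% d)%Z).
have mod_lt (x : int) : (absz (x %% d)%Z < (absz d).-1.+1)%N.
  by rewrite prednK// -ltz_nat gez0_abs ?modz_ge0// abszE ltz_mod.
have phiP z w : phi z = phi w <-> (d %| f (z - w)%R)%Z.
  rewrite fB.
  rewrite -eqz_mod_dvd; split=> [|/eqP zw]; last by rewrite /phi zw.
  move=> /(congr1 (@nat_of_ord _)); rewrite !inordK ?mod_lt//.
  by move=> /(congr1 Posz); rewrite !gez0_abs ?modz_ge0// => ->.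
rewrite (lattice_index_quotient (phi := phi)) ?card_ord ?prednK//.
  move=> t; exists ((t : nat)%:Z *: z0); apply: val_inj => /=; rewrite /phi.
  have -> : f ((t : nat)%:Z *: z0) = (t : nat)%:Z.
    by rewrite /f linearZ/= -scalemxAr mxE Az0 mulr1.
  rewrite inordK ?mod_lt//.
  have td : (t < absz d)%N by rewrite (leq_trans (ltn_ord t))// prednK.
  by rewrite -modz_abs modz_small ?absz_nat// ltz_nat td.
move=> z w; rewrite phiP; split=> [/dvdzP[c zwE]|[z1 z1K [z2 z2K <-]]].
  have AQ i : (A *m (c *: row k Q)^T) i 0 = c * (A *m Q^T) i k.
    rewrite linearZ/= -scalemxAr [LHS]mxE; congr (_ * _).
    by rewrite !mxE; apply: eq_bigr => j _; rewrite !mxE.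
  exists (c *: row k Q).
    by move=> i ik; rewrite AQ tT// mulr0.
  exists (z - w - c *: row k Q); last by rewrite addrC subrK.
  by rewrite /= -[LHS]/(f (_ - _)) fB zwE /f AQ subrr.
rewrite /f linearD/= mulmxDr mxE z2K addr0 splitting_coord mxE (bigD1 k)//=.
rewrite big1 ?addr0 ?dvdz_mulr// => j jk.
have [ltkj|lejk] := ltnP k j; first by rewrite tT// mul0r.
rewrite (trig_mulmx_eq0 trigT diagT (k := k)) ?mulr0//.
  by move=> i ik; rewrite -splitting_coord z1K.
by rewrite ltn_neqAle jk.
Qed.

End LatticeSplitting.

(** The splitting of A' is that of a matrix with b rows, so its kernel basis B' has
    a rows; stacking B' over B gives a square matrix. *)
Section DeterminantIndex.
Variables (a b : nat).
Variables (A : 'M[int]_(a, a + b)) (A' : 'M[int]_(b, a + b)).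
Variables (Q : 'M[int]_(a, a + b)) (B : 'M[int]_(b, a + b)).
Variables (C1 : 'M[int]_(a + b, a)) (C2 : 'M[int]_(a + b, b)).
Variables (Q' : 'M[int]_(b, a + b)) (B' : 'M[int]_(a, a + b)).
Variables (C1' : 'M[int]_(a + b, b)) (C2' : 'M[int]_(a + b, a)).
Hypothesis CQB : C1 *m Q + C2 *m B = 1%:M.
Hypothesis AB0 : A *m B^T = 0.
Hypothesis trigT : is_trig_mx (A *m Q^T).
Hypothesis CQB' : C1' *m Q' + C2' *m B' = 1%:M.
Hypothesis AB0' : A' *m B'^T = 0.
Hypothesis trigT' : is_trig_mx (A' *m Q'^T).
Hypothesis detW : \det (col_mx A A') != 0.

Let absz_detE : absz (\det (col_mx A A')) =
  (absz (\det (A *m Q^T)) * absz (\det (A' *m B^T)))%N.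
Proof.
have Uu : row_mx C1 C2 *m col_mx Q B = 1%:M by rewrite mul_row_col.
have /absz_det_unitmx := (mulmx1_unit Uu).2.
rewrite -det_tr tr_col_mx => U1.
rewrite -[LHS]muln1 -{}U1 -abszM -det_mulmx mul_col_row AB0 det_lblock.
by rewrite abszM.
Qed.

Let absz_detE' : absz (\det (col_mx A A')) =
  (absz (\det (A' *m Q'^T)) * absz (\det (A *m B'^T)))%N.
Proof.
have Uu : row_mx C2' C1' *m col_mx B' Q' = 1%:M by rewrite mul_row_col addrC.
have /absz_det_unitmx := (mulmx1_unit Uu).2.
rewrite -det_tr tr_col_mx => U1.
rewrite -[LHS]muln1 -{}U1 -abszM -det_mulmx mul_col_row AB0' det_ublock.
by rewrite abszM mulnC.
Qed.

Let detW_gt0 : (0 < absz (\det (col_mx A A')))%N.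
Proof. by rewrite absz_gt0. Qed.

Lemma splitting_diag_neq0 i : (A *m Q^T) i i != 0.
Proof.
move: detW_gt0; rewrite absz_detE det_trig// muln_gt0 => /andP[+ _].
by rewrite absz_gt0 => /prodf_neq0; apply.
Qed.

Lemma splitting_diag_neq0' i : (A' *m Q'^T) i i != 0.
Proof.
move: detW_gt0; rewrite absz_detE' det_trig// muln_gt0 => /andP[+ _].
by rewrite absz_gt0 => /prodf_neq0; apply.
Qed.

(** The rows of P are the bases of both kernels, so the index is |det P|. In the
    basis adapted to A, in the basis adapted to A', and on the rows of P, the
    matrix col_mx A A' is block triangular. This gives, with y = det (A' B^T) and
    z = det (A B'^T), the relations |det| = |det T| |y| = |det T'| |z| and
    |det| |det P| = |z| |y|, from which y and z are eliminated. *)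
Lemma absz_det_col_mx : absz (\det (col_mx A A')) =
  (absz (\det (A *m Q^T)) * absz (\det (A' *m Q'^T)) *
   lattice_index (set_add [set z : 'rV[int]_(a + b) | A *m z^T = 0%R]
                          [set z : 'rV[int]_(a + b) | A' *m z^T = 0%R]))%N.
Proof.
pose P := col_mx B' B.
have PW : (absz (\det (col_mx A A')) * absz (\det P) =
    absz (\det (A *m B'^T)) * absz (\det (A' *m B^T)))%N.
  rewrite -(det_tr P) -abszM -det_mulmx tr_col_mx mul_col_row AB0 AB0'.
  by rewrite det_ublock abszM.
have P0 : \det P != 0.
  have := detW_gt0; rewrite {1}absz_detE muln_gt0 => /andP[_ AB].
  have := detW_gt0; rewrite {1}absz_detE' muln_gt0 => /andP[_ AB'].
  have : (0 < absz (\det (col_mx A A')) * absz (\det P))%N.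
    by rewrite PW muln_gt0 AB'.
  by rewrite muln_gt0 => /andP[_]; rewrite absz_gt0.
have -> : set_add [set z : 'rV[int]_(a + b) | A *m z^T = 0]
    [set z : 'rV[int]_(a + b) | A' *m z^T = 0] =
    [set z : 'rV[int]_(a + b) | exists y, z = y *m P].
  have kerA := splitting_kernel CQB AB0 trigT splitting_diag_neq0.
  have kerA' := splitting_kernel CQB' AB0' trigT' splitting_diag_neq0'.
  apply/seteqP; split=> [_ [z /kerA[y ->] [w /kerA'[y' ->] <-]]|_ [y ->]] /=.
    by exists (row_mx y' y); rewrite mul_row_col addrC.
  rewrite -[y]hsubmxK mul_row_col addrC.
  exists (rsubmx y *m B); first by apply/kerA; exists (rsubmx y).
  by exists (lsubmx y *m B') => //; apply/kerA'; exists (lsubmx y).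
rewrite lattice_index_rowspan//.
move: absz_detE absz_detE' PW detW_gt0.
move: (absz (\det (col_mx A A'))) (absz (\det P)) (absz (\det (A *m Q^T))) => w u t.
move: (absz (\det (A' *m Q'^T))) (absz (\det (A *m B'^T))) => t' x.
move: (absz (\det (A' *m B^T))) => y wE1 wE2 wu w_gt0.
apply/eqP; rewrite -(eqn_pmul2l w_gt0); apply/eqP.
have -> : (w * (t * t' * u) = t * t' * (w * u))%N by nia.
rewrite wu {1}wE1 wE2; nia.
Qed.

End DeterminantIndex.

(** * Relative interiors and transverse stable intersections *)

Section ConvexCells.
Variables (R : realType) (n : nat).
Implicit Types (S g h : set 'rV[R]_n) (x y z u v : 'rV[R]_n).

Definition convex_region g : Prop :=
  forall x y (t : R), g x -> g y -> 0 <= t <= 1 -> g (t *: x + (1 - t) *: y).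

Definition direction S : set 'rV[R]_n := lin_span (set_sub S S).

Lemma lin_span_gen S y : S y -> lin_span S y.
Proof.
move=> Sy; exists 1%N, (fun=> 1), (fun=> y); split=> //.
by rewrite big_ord1 scale1r.
Qed.

Lemma lin_span_min S (V : set 'rV[R]_n) :
  V 0 -> (forall u v, V u -> V v -> V (u + v)) ->
  (forall (c : R) u, V u -> V (c *: u)) -> S `<=` V -> lin_span S `<=` V.
Proof.
move=> V0 VD VZ SV _ [k [a [s [Ss ->]]]].
by elim/big_ind: _ => // i _; apply/VZ/SV.
Qed.

Lemma lin_span0 S : lin_span S 0.
Proof.
by exists 0%N, (fun=> 0), (fun=> 0); split=> [[]//|]; rewrite big_ord0.
Qed.

Lemma lin_spanZ S (c : R) u : lin_span S u -> lin_span S (c *: u).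
Proof.
move=> [k [a [s [Ss ->]]]]; exists k, (fun i => c * a i), s; split=> //.
by rewrite scaler_sumr; apply: eq_bigr => i _; rewrite scalerA.
Qed.

Lemma lin_spanD S u v : lin_span S u -> lin_span S v -> lin_span S (u + v).
Proof.
move=> [k [a [s [Ss ->]]]] [l [b [t [St ->]]]].
exists (k + l)%N,
  (fun i => match fintype.split i with inl i => a i | inr j => b j end),
  (fun i => match fintype.split i with inl i => s i | inr j => t j end).
split=> [i|]; first by case: fintype.splitP.
rewrite big_split_ord/=; congr (_ + _); apply: eq_bigr => i _.
  by rewrite (unsplitK (inl i)).
by rewrite (unsplitK (inr i)).
Qed.

Lemma direction_sub S x y : S x -> S y -> direction S (x - y).
Proof. by move=> Sx Sy; apply: lin_span_gen; exists x => //; exists y. Qed.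

Lemma sub_aff_hull S : S `<=` aff_hull S.
Proof.
move=> y Sy; exists 1%N, (fun=> 1), (fun=> y).
by rewrite !big_ord1 scale1r.
Qed.

Lemma aff_hull_translate S p q r (c : R) :
  aff_hull S p -> S q -> S r -> aff_hull S (p + c *: (q - r)).
Proof.
move=> [k [a [s [Ss a1 ->]]]] Sq Sr.
exists (k + 2)%N,
  (fun i => match fintype.split i with inl i => a i
            | inr j => if j == ord0 then c else - c end),
  (fun i => match fintype.split i with inl i => s i
            | inr j => if j == ord0 then q else r end).
split=> [i||].
- by case: fintype.splitP => // j _; case: ifP.
- rewrite big_split_ord/= [X in _ + X]big_ord_recl big_ord1.
  rewrite !(unsplitK (inr _))/= subrr addr0 -[RHS]a1.
  by apply: eq_bigr => i _; rewrite (unsplitK (inl i)).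
- rewrite big_split_ord/= [X in _ = _ + X]big_ord_recl big_ord1.
  rewrite !(unsplitK (inr _))/= scaleNr -scalerBr; congr (_ + _).
  by apply: eq_bigr => i _; rewrite (unsplitK (inl i)).
Qed.

(** The affine hull is the translate of its direction through any point of S. *)
Lemma aff_hullE S y z : S y -> aff_hull S z <-> direction S (z - y).
Proof.
move=> Sy; split=> [[k [a [s [Ss a1 ->]]]]|[k [a [s [Ss zyE]]]]].
  rewrite -[y]scale1r -a1 scaler_suml -sumrB.
  elim/big_ind: _ => [|u v|i _]; first exact: lin_span0.
    exact: lin_spanD.
  by rewrite -scalerBr; apply/lin_spanZ/direction_sub.
rewrite -(subrK y z) addrC {}zyE.
elim/big_rec: _ => [|i u _ yu]; first by rewrite addr0; apply: sub_aff_hull.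
have [q Sq [r Sr <-]] := Ss i.
by rewrite [X in y + X]addrC addrA; apply: aff_hull_translate.
Qed.

Lemma aff_hull_mono S S' : S `<=` S' -> aff_hull S `<=` aff_hull S'.
Proof.
by move=> SS' _ [k [a [s [Ss a1 ->]]]]; exists k, a, s; split=> // i; apply/SS'.
Qed.

Lemma direction_mono S S' : S `<=` S' -> direction S `<=` direction S'.
Proof.
move=> SS' _ [k [a [s [Ss ->]]]]; exists k, a, s; split=> // i.
by have [p /SS' Sp [q /SS' Sq <-]] := Ss i; exists p => //; exists q.
Qed.

Lemma near_ray x u (P : set 'rV[R]_n) :
  (\forall z \near x, P z) -> \forall e \near 0^'+, P (x + e *: u).
Proof.
move=> Px.
have : (fun e : R => x + e *: u) @ 0^'+ --> x + 0 *: u.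
  apply: cvgD; first exact: cvg_cst.
  by apply: cvgZr_tmp; apply: cvg_at_right_filter; exact: cvg_id.
by rewrite scale0r addr0; apply.
Qed.

Lemma near_affine x y (c : R) (P : set 'rV[R]_n) :
  (\forall z \near x, P z) -> \forall z \near y, P (x + c *: (z - y)).
Proof.
move=> Px.
have : (fun z : 'rV[R]_n => x + c *: (z - y)) @ y --> x + c *: (y - y).
  apply: (@cvgD _ _ _ (nbhs y) _ (fun=> x) (fun z => c *: (z - y))).
    exact: cvg_cst.
  apply: (@cvgZ _ _ _ (nbhs y) _ (fun=> c) (fun z => z - y)).
    exact: cvg_cst.
  by apply: (@cvgB _ _ _ (nbhs y) _ id (fun=> y)); [exact: cvg_id|exact: cvg_cst].
by rewrite subrr scaler0 addr0; apply.
Qed.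

Lemma relint_sub S : relint S `<=` S.
Proof. by move=> y []. Qed.

Lemma near_relint S y : relint S y ->
  \forall z \near y, aff_hull S z -> relint S z.
Proof.
move=> [Sy Snear]; have Snear' := nbhs_interior Snear.
near=> z => Sz; split; first by apply: (near Snear).
by near: z.
Unshelve. all: by end_near.
Qed.

Lemma relint_ray S y u : relint S y -> direction S u ->
  \forall e \near 0^'+, relint S (y + e *: u).
Proof.
move=> Sy Su; have Srel := near_ray u (near_relint Sy).
near=> e; apply: (near Srel e) => //.
apply/(aff_hullE _ (relint_sub Sy)); rewrite addrAC subrr add0r.
exact: lin_spanZ.
Unshelve. all: by end_near.
Qed.

(** The homothety of centre y and ratio t maps a neighbourhood of x in the affine
    hull onto a neighbourhood of the new point, and it maps g into g by convexity. *)
Lemma relint_convex g x y (t : R) : convex_region g -> relint g x -> g y ->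
  0 < t <= 1 -> relint g (t *: x + (1 - t) *: y).
Proof.
move=> gconv [gx gnear] gy /andP[t_gt0 t_le1]; set y' := _ + _.
have gy' : g y' by apply: gconv => //; rewrite ltW.
split=> //.
have gnear' := near_affine y' t^-1 gnear.
near=> z => gz.
have gw : g (x + t^-1 *: (z - y')).
  apply: (near gnear' z) => //.
  apply/(aff_hullE _ gx); rewrite addrAC subrr add0r.
  by apply: lin_spanZ; apply/(aff_hullE _ gy').
have -> : z = t *: (x + t^-1 *: (z - y')) + (1 - t) *: y.
  rewrite scalerDr scalerA divff ?gt_eqF// scale1r.
  by apply/rowP => i; rewrite !mxE; ring.
by apply: gconv => //; rewrite ltW.
Unshelve. all: by end_near.
Qed.

Lemma near_right_exists (P : R -> Prop) :
  (\forall e \near 0^'+, P e) -> exists2 e : R, 0 < e & P e.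
Proof.
move=> Pe; have /filter_ex[e [e0 Pe']] : \forall e \near (0:R)^'+, 0 < e /\ P e.
  by near=> e; split; [near: e; exact: nbhs_right_gt|near: e].
by exists e.
Unshelve. all: by end_near.
Qed.

Lemma relint_reflect S x y : S x -> relint S y ->
  exists2 e : R, 0 < e & S (y + e *: (y - x)).
Proof.
move=> Sx Sy; apply: near_right_exists.
have := relint_ray Sy (direction_sub (relint_sub Sy) Sx).
by apply: filterS => e /relint_sub.
Qed.

(** A point of relint (g `&` h) lies strictly between x and a point of g obtained by
    prolonging slightly the segment that comes from x. *)
Lemma relintI_sub g h x : convex_region g -> relint g x -> h x ->
  relint (g `&` h) `<=` relint g.
Proof.
move=> gconv gx hx y ghy.
have [e e_gt0 [gy' _]] := relint_reflect (conj (relint_sub gx) hx) ghy.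
have e1_gt0 : 0 < 1 + e by rewrite addr_gt0.
(* The prolonged point is y + e (y - x); solve for y. *)
have -> : y = (e / (1 + e)) *: x + (1 - e / (1 + e)) *: (y + e *: (y - x)).
  apply/rowP => i; rewrite !mxE; field; lra.
apply: relint_convex => //; rewrite divr_gt0//= ler_pdivrMr// mul1r.
by rewrite lerDr.
Qed.

Lemma relintI_sup g h : relint g `&` relint h `<=` relint (g `&` h).
Proof.
move=> y [[gy gnear] [hy hnear]]; split=> //; near=> z => zgh.
by split; [apply: (near gnear z)|apply: (near hnear z)] => //;
  apply: aff_hull_mono zgh => ? [].
Unshelve. all: by end_near.
Qed.

Lemma relint_setI g h x : convex_region g -> convex_region h ->
  relint g x -> relint h x -> relint (g `&` h) = relint g `&` relint h.
Proof.
move=> gc hc gx hx; apply/seteqP; split=> [y ghy|]; last exact: relintI_sup.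
split; first exact: (relintI_sub gc gx (relint_sub hx)).
by apply: (relintI_sub hc hx (relint_sub gx)); rewrite setIC.
Qed.

(** A short segment at x, in a direction common to g and h, stays in both. *)
Lemma direction_setI g h x : relint g x -> relint h x ->
  direction (g `&` h) = direction g `&` direction h.
Proof.
move=> gx hx; apply/seteqP; split=> [u ghu|u [gu hu]].
  by split; apply: direction_mono ghu => ? [].
have [e e_gt0 [gxe hxe]] : exists2 e : R, 0 < e & (g `&` h) (x + e *: u).
  apply: near_right_exists; have gr := relint_ray gx gu.
  have hr := relint_ray hx hu.
  by near=> e; split; apply: relint_sub; [apply: (near gr e)|apply: (near hr e)].
have -> : u = e^-1 *: ((x + e *: u) - x).
  by rewrite addrAC subrr add0r scalerA mulVf ?scale1r ?gt_eqF.
by apply/lin_spanZ/direction_sub => //; split; apply: relint_sub.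
Unshelve. all: by end_near.
Qed.

Lemma convex_setI g h : convex_region g -> convex_region h -> convex_region (g `&` h).
Proof. by move=> gc hc x y t [gx hx] [gy hy] t01; split; [apply: gc|apply: hc]. Qed.

(** The local model of all the complexes that occur: at the relative interior
    points of g there is no other cell, so there the complex is the linear space
    parallel to g. This is all that has to be known of a complex to intersect it
    transversely, and transverse intersections have the property again. *)
Definition sole_cell (A : complex R n) g : Prop :=
  [/\ cells A g, convex_region g, relint g `<=` supp A
    & forall y s, relint g y -> cells A s -> s y -> s = g].

(** Transversality of two cells: their directions together span the space. A
    difference is used to match the links in the stable intersection. *)
Definition complementary g h : Prop :=
  forall v, exists u w, [/\ direction g u, direction h w & v = u - w].

Lemma sole_cell_facet A g y s : sole_cell A g -> relint g y ->
  (facet A s /\ s y) <-> s = g.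
Proof.
move=> [Ag _ _ gsole] gy; split=> [[[As _] sy]|->]; first exact: gsole gy As sy.
split; last exact: relint_sub.
split=> // t At gt; apply: (gsole y t gy At); exact: (gt y (relint_sub gy)).
Qed.

Lemma direction_link g h y : relint g y -> relint g `<=` h ->
  direction g `<=` link y h.
Proof.
by move=> gy gh u gu; apply: filterS (relint_ray gy gu) => e /gh.
Qed.

(** At a common relative interior point the links contain the directions of g and
    h, so the difference of the links is the whole space and the point belongs to
    the stable intersection. *)
Lemma sole_cell_stable_inter A B g h x :
  sole_cell A g -> sole_cell B h -> complementary g h ->
  relint g x -> relint h x -> sole_cell (stable_inter A B) (g `&` h).
Proof.
move=> [Ag gc gA gsole] [Bh hc hB hsole] ghT gx hx.
have ghsub : relint (g `&` h) `<=` relint g `&` relint h.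
  by rewrite (relint_setI gc hc gx hx).
have ghsupp : relint (g `&` h) `<=` stable_supp A B.
  move=> y /ghsub[gy hy]; apply/seteqP; split=> // v _.
  have [u [w [gu hw ->]]] := ghT v.
  by exists u; [exact: (direction_link gy gA)|exists w; first exact: (direction_link hy hB)].
split=> //.
- split=> //; first by exists x; split; apply: relint_sub.
  by exists g, h.
- exact: convex_setI.
- move=> y _ /ghsub[gy hy] [_ [s [t [As Bt ->]] _]] [sy ty].
  by rewrite (gsole y s) // (hsole y t).
Qed.

(** A facet containing k meets the relative interior of g at a point of relint k,
    so it is g; likewise for h. The difference of the links of g and h is the whole
    space, so the only possible term does occur, for any choice of the generic
    vector and of the point of relint k. The cell k may be smaller than g `&` h:
    this gives the weight at a single point. *)
Lemma stable_inter_weight A B g h k :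
  sole_cell A g -> sole_cell B h -> complementary g h ->
  relint k !=set0 -> k `<=` g `&` h -> relint k `<=` relint g `&` relint h ->
  weight (stable_inter A B) k = weight A g * weight B h *
    (lattice_index (set_add (sublattice g) (sublattice h)))%:Z.
Proof.
move=> gA hB ghT k0 kgh rkgh; rewrite /= /stable_weight.
have kw : relint k (get (relint k)) by apply: getPex.
move: (get (relint k)) kw => w kw; move: (get (generic_direction _ _ _)) => v.
have [gw hw] := rkgh _ kw.
rewrite (_ : [set st | _] = [set (g, h)]) ?fsbig_set1//.
apply/seteqP; split=> [[s t] /= [As ks Bt kt _]|_ ->] /=.
  have kkw := relint_sub kw.
  have -> : s = g.
    by apply: (sole_cell_facet s gA gw).1; split=> //; exact: ks.
  have -> : t = h by apply: (sole_cell_facet t hB hw).1; split=> //; exact: kt.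
  by [].
have [u [u' [gu hu' ->]]] := ghT v.
split; first by have [] := (sole_cell_facet g gA gw).2 erefl.
- by move=> z /kgh[].
- by have [] := (sole_cell_facet h hB hw).2 erefl.
- by move=> z /kgh[].
exists u; first by apply: (direction_link gw (@relint_sub _)).
by exists u' => //; apply: (direction_link hw (@relint_sub _)).
Qed.

End ConvexCells.

(** * Dot products and orthogonality *)

Section DotProduct.
Variables (R : realType) (n : nat).
Implicit Types (u v w x : 'rV[R]_n) (a b : 'rV[int]_n).

Definition dot u v : R := \sum_(i < n) u 0 i * v 0 i.

Lemma dotC u v : dot u v = dot v u.
Proof. by apply: eq_bigr => i _; rewrite mulrC. Qed.

Lemma dotDl u v w : dot (u + v) w = dot u w + dot v w.
Proof.
by rewrite /dot -big_split; apply: eq_bigr => i _; rewrite !mxE mulrDl.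
Qed.

Lemma dotZl (c : R) u w : dot (c *: u) w = c * dot u w.
Proof. by rewrite /dot mulr_sumr; apply: eq_bigr => i _; rewrite !mxE mulrA. Qed.

Lemma dotBl u v w : dot (u - v) w = dot u w - dot v w.
Proof. by rewrite -scaleN1r dotDl dotZl mulN1r. Qed.

Lemma dotZr (c : R) u w : dot w (c *: u) = c * dot w u.
Proof. by rewrite !(dotC w) dotZl. Qed.

Lemma dotBr u v w : dot w (u - v) = dot w u - dot w v.
Proof. by rewrite !(dotC w) dotBl. Qed.

Lemma dot0l w : dot 0 w = 0.
Proof. by rewrite -(scale0r w) dotZl mul0r. Qed.

Lemma dot_ge0 u : 0 <= dot u u.
Proof. by apply: sumr_ge0 => i _; rewrite -expr2 sqr_ge0. Qed.

Lemma dot_eq0 u : (dot u u == 0) = (u == 0).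
Proof.
apply/idP/idP => [|/eqP ->]; last by rewrite dot0l.
rewrite /dot psumr_eq0 => [/allP uu|i _]; last by rewrite -expr2 sqr_ge0.
apply/eqP/rowP => i; rewrite mxE; apply/eqP.
by have := uu i (mem_index_enum _); rewrite -expr2 sqrf_eq0.
Qed.

Lemma dot_gt0 u : u != 0 -> 0 < dot u u.
Proof. by move=> u0; rewrite lt_neqAle dot_ge0 eq_sym dot_eq0 u0. Qed.

(** Apply the hypothesis to the component of v orthogonal to u. *)
Lemma orthogonal_parallel u v : u != 0 ->
  (forall w, dot w u = 0 -> dot w v = 0) -> exists t : R, v = t *: u.
Proof.
move=> u0 uv; exists (dot v u / dot u u); apply/eqP; rewrite -subr_eq0 -dot_eq0.
have wu : dot (v - (dot v u / dot u u) *: u) u = 0.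
  by rewrite dotBl dotZl divfK ?subrr ?dot_eq0.
by rewrite dotBr dotZr wu uv// mulr0 subrr.
Qed.

Lemma direction_dot (S : set 'rV[R]_n) u w :
  (forall y z, S y -> S z -> dot (y - z) w = 0) -> direction S u -> dot u w = 0.
Proof.
move=> Sw; apply: (lin_span_min (V := [set u | dot u w = 0])) => /=.
- exact: dot0l.
- by move=> v v'; rewrite dotDl => -> ->; rewrite addr0.
- by move=> c v; rewrite dotZl => ->; rewrite mulr0.
- by move=> _ [y Sy [z Sz <-]]; apply: Sw.
Qed.

Lemma pairingE x a : pairing x a = dot x (to_real R a).
Proof. by apply: eq_bigr => i _; rewrite mxE. Qed.

Lemma to_realB a b : to_real R (a - b) = to_real R a - to_real R b.
Proof. by apply/rowP => i; rewrite !mxE rmorphB. Qed.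

Lemma to_real_inj : injective (@to_real R n).
Proof.
move=> a b /rowP ab; apply/rowP => i; have := ab i; rewrite !mxE.
exact: intr_inj.
Qed.

Lemma to_real_eq0 a : to_real R a = 0 -> a = 0.
Proof.
by move=> a0; apply: to_real_inj; rewrite a0; apply/rowP => i; rewrite !mxE.
Qed.

Lemma multiple_neq0 a b u (t : R) : a != b -> to_real R (a - b) = t *: u ->
  t != 0 /\ u != 0.
Proof.
rewrite -subr_eq0 => ab abE; split; apply: contra ab => /eqP tu0; apply/eqP;
  by apply: to_real_eq0; rewrite abE tu0 ?scale0r ?scaler0.
Qed.

Lemma continuous_dot w : continuous (fun y : 'rV[R]_n => dot y w).
Proof.
apply: continuous_big => [|i _ x]; first exact: add_continuous.
apply: (@cvgM _ _ (nbhs x) _ (fun z => z 0 i) (fun=> w 0 i)).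
  exact: coord_continuous.
exact: cvg_cst.
Qed.

End DotProduct.

(** * A tropical hypersurface near a point dual to an edge *)

Section TropicalHypersurface.
Variables (R : realType) (n : nat) (p : tpoly R n).
Implicit Types (x y z u d : 'rV[R]_n) (a b c : 'rV[int]_n) (g : set 'rV[R]_n).

Lemma exponents_argmax (P : set 'rV[int]_n) (f : 'rV[int]_n -> R) a :
  P a -> a \in exponents p -> exists b, [/\ P b, b \in exponents p &
    forall c, P c -> c \in exponents p -> f c <= f b].
Proof.
move=> Pa pa; have Pa' : `[< P (val [` pa]%fset) >] by apply/asboolP.
have [b /asboolP Pb bmax] := arg_maxP (P := [pred i | `[< P (val i) >]])
  (fun i : exponents p => f (val i)) Pa'.
exists (val b); split=> [//||c Pc pc]; first exact: valP.
by have := bmax [` pc]%fset; apply; apply/asboolP.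
Qed.

Lemma active_neq0 x : exists a, attains p x a.
Proof.
have /fset0Pn[a0 pa0] := exponents_neq0 p.
have [a [_ pa amax]] := @exponents_argmax setT (fun a => tterm p a x) a0 I pa0.
by exists a; split=> // b pb; apply: amax.
Qed.

Lemma attains_eq x a b : attains p x a -> attains p x b ->
  tterm p a x = tterm p b x.
Proof. by move=> [pa amax] [pb bmax]; apply/eqP; rewrite eq_le bmax ?amax. Qed.

Lemma attains_ge x a b : attains p x a -> b \in exponents p ->
  tterm p a x <= tterm p b x -> attains p x b.
Proof. by move=> [pa amax] pb ab; split=> // c /amax /le_trans; apply. Qed.

Lemma tterm_shift a x u : tterm p a (x + u) = tterm p a x + pairing u a.
Proof. by rewrite /tterm !pairingE dotDl addrAC. Qed.

Lemma tterm_from a x z : tterm p a z = tterm p a x + pairing (z - x) a.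
Proof. by rewrite -tterm_shift addrC subrK. Qed.

Lemma tterm_convex a x y (t : R) : tterm p a (t *: x + (1 - t) *: y) =
  t * tterm p a x + (1 - t) * tterm p a y.
Proof. by rewrite /tterm !pairingE dotDl !dotZl; ring. Qed.

Lemma near_right_lt (k e : R) : 0 < e -> \forall t \near 0^'+, t * k < e.
Proof.
move=> e0; near=> t; have t0 : 0 < t by near: t; exact: nbhs_right_gt.
have k0 : 0 < `|k| + 1 by rewrite ltr_wpDl.
have te : t < e / (`|k| + 1) by near: t; apply: nbhs_right_lt; rewrite divr_gt0.
rewrite ltr_pdivlMr// in te; apply: le_lt_trans te.
by rewrite ler_pM2l// (le_trans (ler_norm _))// lerDl.
Unshelve. all: by end_near.
Qed.

(** For small positive e the terms are ordered at x + e u lexicographically: by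
    their value at x, then by their slope along u. *)
Lemma active_ray x u : \forall e \near 0^'+, attains p (x + e *: u) =
  [set a | attains p x a /\ forall b, attains p x b -> pairing u b <= pairing u a].
Proof.
set M := [set a | _].
have [a1 a1x] := active_neq0 x.
have [a [ax pa amax]] :=
  @exponents_argmax (attains p x) (pairing u) a1 a1x a1x.1.
have Ma : M a by split=> // b bx; apply: amax => //; case: bx.
have Meq e b : M b -> tterm p b (x + e *: u) = tterm p a (x + e *: u).
  move=> [bx bmax]; rewrite !tterm_shift (attains_eq bx ax) !pairingE !dotZl.
  congr (_ + _ * _); rewrite -!pairingE; apply/eqP; rewrite eq_le bmax//.
  by rewrite amax//; case: bx.
have Mlt : \forall e \near 0^'+, forall i : exponents p, ~ M (val i) ->
    tterm p (val i) (x + e *: u) < tterm p a (x + e *: u).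
  apply: filter_forall => i; have [Mi|Mi] := pselect (M (val i)).
    by apply: nearW.
  have iE e : (tterm p (val i) (x + e *: u) < tterm p a (x + e *: u)) =
      (e * (pairing u (val i) - pairing u a) < tterm p a x - tterm p (val i) x).
    rewrite !tterm_shift !pairingE !dotZl; apply/idP/idP; lra.
  have := ax.2 (val i) (valP i); rewrite le_eqVlt => /orP[/eqP ixa|ixa].
    have ix : attains p x (val i).
      by apply: attains_ge ax (valP i) _; rewrite ixa.
    have ia : pairing u (val i) < pairing u a.
      rewrite lt_neqAle amax ?(valP i)// andbT; apply/eqP => ia; apply: Mi.
      by split=> // b bx; rewrite ia amax//; case: bx.
    apply: filterS (nbhs_right_gt 0) => e e_gt0 _.
    by rewrite iE ixa subrr pmulr_rlt0 ?subr_lt0.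
  have : 0 < tterm p a x - tterm p (val i) x by rewrite subr_gt0.
  move=> /(near_right_lt (pairing u (val i) - pairing u a)).
  by apply: filterS => e ? _; rewrite iE.
apply: filterS Mlt => e Mlt; apply/seteqP; split=> [c cx|c Mc].
  apply: contrapT => Mc; have [pc cmax] := cx.
  suff : tterm p c (x + e *: u) < tterm p a (x + e *: u).
    by rewrite ltNge cmax.
  exact: (Mlt [` pc]%fset).
split=> [|b pb]; first by case: Mc => -[].
rewrite (Meq _ _ Mc); have [/Meq -> //|Mb] := pselect (M b).
by rewrite ltW//; exact: (Mlt [` pb]%fset).
Qed.

(** The smallest cell of the hypersurface that contains x. *)
Definition cell_at x : set 'rV[R]_n := [set y | attains p x `<=` attains p y].

Lemma attains_cell_convex (S : set 'rV[int]_n) :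
  convex_region [set y | S `<=` attains p y].
Proof.
move=> x y t Sx Sy /andP[t0 t1] a Sa.
have [[pa ax] [_ ay]] := (Sx a Sa, Sy a Sa); split=> // b pb.
by rewrite !tterm_convex lerD// ler_wpM2l ?subr_ge0 ?ax ?ay.
Qed.

(** A term maximal at y and not at z would exceed, by affinity, the terms of S on
    the prolongation of the segment from z to y. *)
Lemma relint_attains (S : set 'rV[int]_n) y z c :
  S !=set0 -> relint [set y | S `<=` attains p y] y -> S `<=` attains p z ->
  attains p y c -> attains p z c.
Proof.
move=> [a Sa] Sy Sz yc.
have [e e0 /(_ a Sa)[_ amax]] := relint_reflect Sz Sy.
have [pc cmax] := yc; apply: (attains_ge (Sz a Sa)) => //.
have /= /(_ a Sa) ya := relint_sub Sy.
move: (amax _ pc); rewrite !tterm_shift (attains_eq ya yc) lerD2l.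
rewrite !pairingE !dotZl ler_pM2l// !dotBl -!pairingE => yz.
have := attains_eq ya yc; move: yz; rewrite /tterm; lra.
Qed.

(** The cell dual to x is a segment of direction d. *)
Definition edge_at x d : Prop :=
  (exists a b, [/\ a != b, attains p x a & attains p x b]) /\
  (forall a b, attains p x a -> attains p x b ->
     exists t : R, to_real R (a - b) = t *: d).

Section Edge.
Variables (x d : 'rV[R]_n).
Hypothesis xd : edge_at x d.

Lemma edge_neq0 : d != 0.
Proof.
have [[a [b [ab ax bx]]] /(_ _ _ ax bx)[t abE]] := xd.
by have [] := multiple_neq0 ab abE.
Qed.

Lemma direction_cell_attains u a b : direction (cell_at x) u ->
  attains p x a -> attains p x b -> pairing u a = pairing u b.
Proof.
move=> ud ax bx; apply/eqP; rewrite -subr_eq0 !pairingE -dotBr; apply/eqP.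
apply: direction_dot ud => y z xy xz; rewrite !dotBl !dotBr.
have := attains_eq (xy a ax) (xy b bx); have := attains_eq (xz a ax) (xz b bx).
rewrite /tterm !pairingE; lra.
Qed.

(** Moving from x orthogonally to d changes all the maximal terms equally, so it
    stays in the cell as long as the other terms remain smaller. *)
Lemma direction_cell_at : direction (cell_at x) = [set u | dot u d = 0].
Proof.
have [[a [b [ab ax bx]]] xline] := xd.
apply/seteqP; split=> u /= ud.
  have [t abE] := xline _ _ ax bx.
  have [t0 _] := multiple_neq0 ab abE.
  have := direction_cell_attains ud ax bx; rewrite !pairingE => /eqP.
  rewrite -subr_eq0 -dotBr -to_realB abE dotZr mulf_eq0 (negPf t0).
  by move=> /eqP.
have uE c c' : attains p x c -> attains p x c' -> pairing u c = pairing u c'.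
  move=> cx c'x; have [t cc'] := xline _ _ cx c'x; apply/eqP.
  by rewrite !pairingE -subr_eq0 -dotBr -to_realB cc' dotZr ud mulr0.
have [e e0 xe] : exists2 e : R, 0 < e & cell_at x (x + e *: u).
  apply: near_right_exists; apply: filterS (active_ray x u) => e eE c cx.
  by rewrite eE; split=> // c' c'x; rewrite (uE c' c).
have -> : u = e^-1 *: ((x + e *: u) - x).
  by rewrite addrAC subrr add0r scalerA mulVf ?scale1r ?gt_eqF.
by apply/lin_spanZ/direction_sub.
Qed.

Lemma relint_cell_at : relint (cell_at x) x.
Proof.
split=> //; have [a ax] := active_neq0 x.
have lt_near : \forall z \near x, forall i : exponents p,
    ~ attains p x (val i) -> tterm p (val i) z < tterm p a z.
  apply: (@filter_forall _ _ _ (nbhs x)) => i; have [ix|ix] := pselect (attains p x (val i)).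
    by apply: nearW.
  have ixa : tterm p (val i) x < tterm p a x.
    by rewrite ltNge; apply/negP => /(attains_ge ax (valP i)).
  have tcvg c : tterm p c z @[z --> x] --> tterm p c x.
    apply: (@cvgD _ _ _ (nbhs x) _ (fun z => pairing z c) (fun=> coef p c)).
      under eq_fun do rewrite pairingE.
      by rewrite pairingE; apply: continuous_dot.
    exact: cvg_cst.
  have pos : 0 < tterm p a x - tterm p (val i) x by rewrite subr_gt0.
  have : \forall z \near nbhs x, 0 < tterm p a z - tterm p (val i) z.
    exact: (cvgr_gt _ (cvgB (tcvg a) (tcvg (val i))) _ pos).
  by apply: filterS => z /=; rewrite subr_gt0.
apply: (@filterS _ (nbhs x) _) lt_near => z lt_near xz c cx; split=> [|b pb]; first by case: cx.
have eqz b' : attains p x b' -> tterm p b' z = tterm p a z.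
  move=> bx; have zx : direction (cell_at x) (z - x) by apply/aff_hullE.
  by rewrite !(tterm_from _ x z) (attains_eq bx ax)
    (direction_cell_attains zx bx ax).
rewrite (eqz c)//; have [/eqz -> //|bx] := pselect (attains p x b).
by rewrite ltW//; exact: (lt_near [` pb]%fset).
Qed.

(** The exponents maximal at x lie on a line and their terms agree at x; so at any
    point where two of these terms agree, all of them do. Hence a cell defined by
    two of the maximal terms is already cell_at x. *)
Lemma sole_cell_at : sole_cell (hypersurface p) (cell_at x).
Proof.
have [[a [b [ab ax bx]]] xline] := xd.
split.
- split; first by exists x.
  exists a, b, (attains p x); split=> //.
- exact: attains_cell_convex.
- by move=> y /relint_sub xy; exists a, b; split=> //; apply: xy.
move=> y s xy [_ [a' [b' [S [a'b' Sa' Sb' ->]]]]] /= Sy.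
have Sx : S `<=` attains p x.
  move=> c /Sy cy; apply: (relint_attains _ xy) => //; exact: active_neq0.
apply/seteqP; split=> z /= Sz c; last by move=> /Sx; apply: Sz.
move=> cx; have a'x := Sx _ Sa'; have b'x := Sx _ Sb'.
apply: (attains_ge (Sz _ Sa')); first by case: cx.
have [t1 abE] := xline _ _ b'x a'x; have [t2 caE] := xline _ _ cx a'x.
have [t1_neq0 _] : t1 != 0 /\ d != 0.
  by apply: multiple_neq0 abE; rewrite eq_sym.
have zxd : dot (z - x) d = 0.
  have := attains_eq (Sz _ Sb') (Sz _ Sa').
  rewrite !(tterm_from _ x z) (attains_eq b'x a'x) => /addrI /eqP.
  rewrite !pairingE -subr_eq0 -dotBr -to_realB abE dotZr.
  by rewrite mulf_eq0 (negPf t1_neq0) => /eqP.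
rewrite !(tterm_from _ x z) (attains_eq cx a'x) lerD2l.
by rewrite -subr_ge0 !pairingE -dotBr -to_realB caE dotZr zxd mulr0.
Qed.

(** The normal is orthogonal to the direction of the cell, which is the orthogonal
    of d. *)
Lemma edge_at_normal nu : primitive_normal (cell_at x) nu -> nu != 0 ->
  edge_at x (to_real R nu).
Proof.
move=> [_ nuP] nu0; have [xab xline] := xd; split=> // a b ax bx.
have [t nuE] : exists t : R, to_real R nu = t *: d.
  apply: orthogonal_parallel edge_neq0 _ => w wd.
  have : direction (cell_at x) w by rewrite direction_cell_at.
  by apply: direction_dot => y z xy xz; rewrite -pairingE; apply: nuP.
have t0 : t != 0.
  apply: contra nu0 => /eqP t0; apply/eqP/(@to_real_eq0 R).
  by rewrite nuE t0 scale0r.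
have [s abE] := xline _ _ ax bx; exists (s / t).
by rewrite nuE scalerA divfK.
Qed.

End Edge.

End TropicalHypersurface.

(** * Facets of a tropical hypersurface are dual to edges *)

Section FacetsAreDualToEdges.
Variables (R : realType) (n : nat) (p : tpoly R n).
Implicit Types (x y z u d : 'rV[R]_n) (a b c : 'rV[int]_n) (g : set 'rV[R]_n).

Lemma cell_relint g x : cells (hypersurface p) g -> relint g x ->
  g = cell_at p x /\ exists a b, [/\ a != b, attains p x a & attains p x b].
Proof.
move=> [_ [a [b [S [ab Sa Sb gE]]]]] gx; rewrite gE in gx *.
have /= Sx := relint_sub gx; split; last by exists a, b; split=> //; apply: Sx.
apply/seteqP; split=> z /= Sz c; last by move=> /Sx; apply: Sz.
by apply: (relint_attains _ gx) => //; exists a.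
Qed.

(** By strict convexity of the norm, an exponent of largest norm is a vertex,
    singled out by the linear form it defines. *)
Lemma extreme_exponent a b : dot (to_real R b) (to_real R b) <=
    dot (to_real R a) (to_real R a) -> b != a ->
  dot (to_real R a) (to_real R b - to_real R a) < 0.
Proof.
move=> ba neq_ba; have /dot_gt0 : to_real R (b - a) != 0.
  by apply: contra neq_ba => /eqP/to_real_eq0/eqP; rewrite subr_eq0.
rewrite to_realB !dotBl !dotBr (dotC (to_real R b) (to_real R a)); lra.
Qed.

(** The exponent a is the only one to maximize the linear form A. If u were
    constant on the line ab and increased from a to c, one could tilt A towards u
    until some exponent d ties with a for the first time. The resulting form w
    still decreases from a to b. In the direction w, the exponents a and d remain
    maximal while b does not; so the cell on which a and d are maximal would be
    strictly larger than the facet g. *)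
Lemma facet_orthogonal g x a b c u : facet (hypersurface p) g -> relint g x ->
  attains p x a -> attains p x b -> attains p x c ->
  (forall b', attains p x b' -> dot (to_real R b') (to_real R b') <=
    dot (to_real R a) (to_real R a)) -> b != a ->
  dot u (to_real R b - to_real R a) = 0 ->
  ~ 0 < dot u (to_real R c - to_real R a).
Proof.
move=> [gcell gmax] gx ax bx cx amax ba ub uc.
have [gE _] := cell_relint gcell gx.
pose A := to_real R a.
pose slope b' := dot A (to_real R b' - A) / dot u (to_real R b' - A).
have [d [[dx ud] _ dmax]] := exponents_argmax (p := p)
  (P := [set b' | attains p x b' /\ 0 < dot u (to_real R b' - A)])
  slope (conj cx uc) cx.1.
have da : d != a.
  by apply: contraTneq ud => ->; rewrite subrr dotC dot0l ltxx.
(* The tilt - slope d is the least one at which an exponent ties with a. *)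
pose w := A + (- slope d) *: u.
have wE b' : dot w (to_real R b' - A) =
    dot A (to_real R b' - A) - slope d * dot u (to_real R b' - A).
  by rewrite dotDl dotZl mulNr.
have slope_lt0 : slope d < 0.
  by rewrite /slope pmulr_llt0 ?invr_gt0//; apply: extreme_exponent => //; apply: amax.
have wd : dot w (to_real R d - A) = 0 by rewrite wE divfK ?subrr// gt_eqF.
have wb : dot w (to_real R b - A) < 0.
  by rewrite wE ub mulr0 subr0; apply: extreme_exponent => //; apply: amax.
have wle b' : attains p x b' -> dot w (to_real R b' - A) <= 0.
  move=> b'x; rewrite wE subr_le0.
  have [ub'|ub'] := ltP 0 (dot u (to_real R b' - A)).
    by rewrite -ler_pdivrMr//; apply: dmax => //; case: b'x.
  apply: (@le_trans _ _ 0); last by rewrite mulr_le0// ltW.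
  have [->|b'a] := eqVneq b' a; first by rewrite subrr dotC dot0l.
  by apply/ltW/extreme_exponent => //; apply: amax.
have pairle b1 b2 : dot w (to_real R b1 - A) <= dot w (to_real R b2 - A) ->
    pairing w b1 <= pairing w b2.
  by rewrite !dotBr lerD2r !pairingE.
pose h := [set y | [set a; d] `<=` attains p y].
have hg : h = g.
  apply: gmax; last by rewrite gE => y xy _ [->|->]; apply: xy.
  split; first by exists x => _ [->|->].
  by exists a, d, [set a; d]; split=> //; [rewrite eq_sym|left|right].
have [e e0 xe] : exists2 e : R, 0 < e & attains p (x + e *: w) =
    [set a | attains p x a /\ forall b, attains p x b -> pairing w b <= pairing w a].
  by apply: near_right_exists; apply: active_ray.
have : h (x + e *: w).
  move=> _ [->|->]; rewrite xe; split=> // b' b'x; apply: pairle.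
    by rewrite subrr dotC (dotC w) dot0l -(dotC w) wle.
  by rewrite wd wle.
rewrite hg gE => /(_ b bx); rewrite xe => -[_ /(_ a ax)].
move: wb; rewrite dotBr !pairingE -/A; lra.
Qed.

(** With a an exponent of largest norm and b another one, every linear form that is
    constant on the line ab is constant on all exponents maximal at x. *)
Lemma facet_edge g x : facet (hypersurface p) g -> relint g x ->
  exists d, edge_at p x d.
Proof.
move=> gfacet gx; have [gE [a1 [a2 [a12 a1x a2x]]]] := cell_relint gfacet.1 gx.
have [a [ax _ amax']] := exponents_argmax (p := p) (P := attains p x)
  (fun b => dot (to_real R b) (to_real R b)) a1x a1x.1.
have amax b : attains p x b -> dot (to_real R b) (to_real R b) <=
    dot (to_real R a) (to_real R a).
  by move=> bx; apply: amax' => //; case: bx.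
have [b [bx ba]] : exists b, attains p x b /\ b != a.
  by have [a1a|] := eqVneq a1 a; [exists a2; rewrite -a1a eq_sym|exists a1].
have ba0 : to_real R b - to_real R a != 0.
  rewrite -to_realB; apply: contra ba => /eqP/to_real_eq0/eqP.
  by rewrite subr_eq0.
have line c : attains p x c -> exists t : R,
    to_real R c - to_real R a = t *: (to_real R b - to_real R a).
  move=> cx; apply: orthogonal_parallel ba0 _ => w wb.
  have := facet_orthogonal gfacet gx ax bx cx amax ba wb.
  (* The previous lemma excludes an increase along w and along - w. *)
  have wNb : dot (- 1 *: w) (to_real R b - to_real R a) = 0.
    by rewrite dotZl wb mulr0.
  have := facet_orthogonal gfacet gx ax bx cx amax ba wNb.
  by rewrite dotZl mulN1r oppr_gt0 => /negP + /negP; rewrite -!leNgt; lra.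
exists (to_real R b - to_real R a); split; first by exists a1, a2.
move=> c c' cx c'x; have [t cE] := line c cx; have [t' c'E] := line c' c'x.
exists (t - t'); rewrite to_realB scalerBl -cE -c'E.
by rewrite opprB addrA subrK.
Qed.

End FacetsAreDualToEdges.

(** * Dual edges as primitive lattice segments *)

Section DualSegments.
Variables (R : realType) (n : nat).
Implicit Types (a b u v z nu : 'rV[int]_n) (S : set 'rV[R]_n).

(** Comparing contents in the proportionality nu_i z = z_i nu gives |nu_i| = |z_i|. *)
Lemma primitive_parallel z nu (t : R) : Defs.content z = 1%N -> Defs.content nu = 1%N ->
  to_real R z = t *: to_real R nu -> z = nu \/ z = - nu.
Proof.
move=> z1 nu1 ztnu.
have [i nui] : exists i, nu 0 i != 0.
  apply/rV0Pn; apply: contraPneq nu1 => ->; first by rewrite content0.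
have zE : nu 0 i *: z = z 0 i *: nu.
  apply: (@to_real_inj R); apply/rowP => j; rewrite !mxE !rmorphM/=.
  have := congr1 (fun w : 'rV[R]_n => w 0 i) ztnu.
  have := congr1 (fun w : 'rV[R]_n => w 0 j) ztnu.
  by rewrite !mxE => -> ->; ring.
have := congr1 (@Defs.content n) zE; rewrite !contentZ z1 nu1 !muln1 => /eqP.
rewrite -abszN => /eqP; rewrite abszN => zi.
have : nu 0 i = z 0 i \/ nu 0 i = - z 0 i by lia.
have zEj j : nu 0 i * z 0 j = z 0 i * nu 0 j.
  by have := congr1 (fun w : 'rV[int]_n => w 0 j) zE; rewrite !mxE.
by move=> [zi'|zi']; [left|right]; apply/rowP => j; apply: (mulfI nui);
  rewrite zEj zi' ?mxE ?mulrNN.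
Qed.

Lemma sub_conv_hull S : S `<=` conv_hull S.
Proof.
move=> y Sy; exists 1%N, (fun=> 1), (fun=> y).
by rewrite !big_ord1 scale1r; split.
Qed.

Lemma conv_hull_sub_aff S : conv_hull S `<=` aff_hull S.
Proof. by move=> _ [k [a [s [Ss _ a1 ->]]]]; exists k, a, s. Qed.

Lemma segmentC u v : @segment R n u v = @segment R n v u.
Proof. by rewrite /segment setUC. Qed.

Lemma segmentE u v : @segment R n u v =
  [set y | exists2 t : R, 0 <= t <= 1 & y = to_real R u + t *: to_real R (v - u)].
Proof.
apply/seteqP; split=> [_ [k [a [s [Ss a0 a1 ->]]]]|_ [t /andP[t0 t1] ->]].
  have /choice[th thP] (i : 'I_k) : exists th : R, 0 <= th <= 1 /\
      s i = to_real R u + th *: to_real R (v - u).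
    have [->|->] := Ss i; first by exists 0; rewrite scale0r addr0 lexx ler01.
    by exists 1; rewrite scale1r to_realB addrC subrK lexx ler01.
  exists (\sum_i a i * th i).
    apply/andP; split.
      by apply: sumr_ge0 => i _; rewrite mulr_ge0//; have [/andP[]] := thP i.
    rewrite -a1; apply: ler_sum => i _; rewrite ler_piMr//.
    by have [/andP[]] := thP i.
  rewrite -[to_real R u]scale1r -a1 !scaler_suml -big_split/=.
  by apply: eq_bigr => i _; have [_ ->] := thP i; rewrite scalerDr scalerA.
exists 2%N, (fun i => if i == ord0 then 1 - t else t),
  (fun i => if i == ord0 then to_real R u else to_real R v); split.
- by move=> i; case: ifP => _; [left|right].
- by move=> i; case: ifP => _; rewrite ?subr_ge0.
- by rewrite big_ord_recl big_ord1/= subrK.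
- rewrite big_ord_recl big_ord1/= to_realB scalerBl scale1r scalerBr.
  by rewrite addrAC addrA.
Qed.

Lemma segment_sub_scale u v u' v' : @segment R n u v `<=` @segment R n u' v' ->
  exists2 t : R, `|t| <= 1 & to_real R (v - u) = t *: to_real R (v' - u').
Proof.
move=> uv.
have : @segment R n u' v' (to_real R u) by apply/uv/sub_conv_hull; left.
have : @segment R n u' v' (to_real R v) by apply/uv/sub_conv_hull; right.
rewrite segmentE => -[t /andP[t0 t1] vE] [s /andP[s0 s1] uE].
exists (t - s); first by rewrite ler_norml; apply/andP; split; lra.
by rewrite to_realB vE uE opprD addrACA subrr add0r scalerBl.
Qed.

(** If two lattice segments are equal as sets, then each difference of endpoints is
    a multiple of the other by a factor of absolute value at most 1, so they agree
    up to sign and have the same content. *)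
Lemma lattice_length_segment u v :
  lattice_length (@segment R n u v) = Defs.content (v - u).
Proof.
rewrite /lattice_length; set P := [set l | _].
have [u' [v' [uvE ->]]] : P (get P).
  by apply: getPex; exists (Defs.content (v - u)), u, v.
have [t t1 E] : exists2 t : R, `|t| <= 1 &
    to_real R (v - u) = t *: to_real R (v' - u').
  by apply: segment_sub_scale; rewrite uvE.
have [t' t'1 E'] : exists2 t : R, `|t| <= 1 &
    to_real R (v' - u') = t *: to_real R (v - u).
  by apply: segment_sub_scale; rewrite uvE.
have [vu|vu] := eqVneq (v - u) 0.
  have -> : v' - u' = 0.
    apply: (@to_real_eq0 R); rewrite E' vu.
    by apply/rowP => i; rewrite !mxE mulr0.
  by rewrite vu.
have tt' : t * t' = 1.
  have : (t * t' - 1) *: to_real R (v - u) = 0.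
    by rewrite scalerBl -scalerA -E' -E scale1r subrr.
  move=> /eqP; rewrite scaler_eq0 => /orP[|/eqP/to_real_eq0/eqP]; last first.
    by rewrite (negPf vu).
  by rewrite subr_eq0 => /eqP.
have t_norm : `|t| = 1.
  apply/eqP; rewrite eq_le t1/= -(normr1 R) -tt' normrM.
  by rewrite ler_piMr.
have [te|te] : t = 1 \/ t = - 1.
  by move/eqP: t_norm; rewrite eqr_norml ler01 andbT => /orP[]/eqP; [left|right].
- by have /to_real_inj -> : to_real R (v - u) = to_real R (v' - u')
    by rewrite E te scale1r.
- have /to_real_inj -> : to_real R (v - u) = to_real R (- 1 *: (v' - u')).
    by rewrite E te; apply/rowP => i; rewrite !mxE rmorphM/= rmorphN1.
  by rewrite contentZ mul1n.
Qed.

Variables (p : tpoly R n) (x : 'rV[R]_n) (nu : 'rV[int]_n).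
Hypothesis nu1 : Defs.content nu = 1%N.
Hypothesis edge_nu : edge_at p x (to_real R nu).

Lemma dual_cell_at : dual_cell p (cell_at p x) =
  conv_hull [set to_real R a | a in attains p x].
Proof.
rewrite /dual_cell; congr (conv_hull (_ @` _)).
by apply/seteqP; split=> [a|a ax y]; apply.
Qed.

(** Both v - u and nu are primitive vectors on the line of the dual cell, so they
    agree up to sign; the sign is absorbed by exchanging the endpoints. *)
Lemma primitive_segment u v : Defs.content (v - u) = 1%N ->
  dual_cell p (cell_at p x) = @segment R n u v ->
  exists w, dual_cell p (cell_at p x) = @segment R n w (w + nu).
Proof.
move=> uv1 uvE; pose S := [set to_real R a | a in attains p x].
have Suv : @segment R n u v `<=` aff_hull S.
  by rewrite -uvE dual_cell_at; apply: conv_hull_sub_aff.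
have [t vuE] : exists t : R, to_real R (v - u) = t *: to_real R nu.
  have [a ax] := active_neq0 p x.
  have Sa : S (to_real R a) by exists a.
  have Su : aff_hull S (to_real R u) by apply/Suv/sub_conv_hull; left.
  have Sv : aff_hull S (to_real R v) by apply/Suv/sub_conv_hull; right.
  have : direction S (to_real R (v - u)).
    have -> : to_real R (v - u) = (to_real R v - to_real R a) +
        (- 1) *: (to_real R u - to_real R a).
      by rewrite to_realB scaleN1r opprB addrA subrK.
    by apply: lin_spanD; [|apply: lin_spanZ]; apply/aff_hullE.
  apply: (lin_span_min (V := [set y | exists t : R, y = t *: to_real R nu])).
  - by exists 0; rewrite scale0r.
  - by move=> _ _ [t ->] [s ->]; exists (t + s); rewrite scalerDl.
  - by move=> c _ [t ->]; exists (c * t); rewrite scalerA.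
  move=> _ [_ [b bx <-] [_ [c cx <-] <-]]; rewrite -to_realB.
  by apply: edge_nu.2.
have [vu|vu] := primitive_parallel uv1 nu1 vuE.
  by exists u; rewrite -vu addrC subrK.
by exists v; rewrite -[nu]opprK -vu opprB addrC subrK segmentC.
Qed.

Lemma dual_segment_weight1 : weight (hypersurface p) (cell_at p x) = 1 ->
  exists w, dual_cell p (cell_at p x) = @segment R n w (w + nu).
Proof.
rewrite /= /lattice_length; set P := [set l | _] => -[P1].
have [l Pl] : exists l, P l.
  (* The choice operator returns 0 on an empty set, whereas the length is 1. *)
  by apply: contrapT => /forallNP/getPN P0; rewrite P0 in P1.
have [u [v [uvE uv]]] : P (get P) by apply: getPex; exists l.
by apply: (primitive_segment (u := u) (v := v)); rewrite // -uv P1.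
Qed.

Hypothesis p_hyperplane : tropical_hyperplane p.

(** The simplex lies in the unit cube. *)
Lemma hyperplane_exponent a : a \in exponents p -> forall i, a 0 i = 0 \/ a 0 i = 1.
Proof.
move=> pa i; have : newton p (to_real R a) by apply: sub_conv_hull; exists a.
rewrite p_hyperplane => -[k [c [s [Ss c0 c1 aE]]]].
have s01 j : 0 <= s j 0 i <= 1.
  have [->|[l _ <-]] := Ss j; first by rewrite mxE lexx ler01.
  by rewrite mxE eqxx/=; case: (i == l); rewrite ?lexx ?ler01.
have aiE : ((a 0 i)%:~R : R) = \sum_j c j * s j 0 i.
  have := congr1 (fun w : 'rV[R]_n => w 0 i) aE; rewrite mxE => ->.
  by rewrite summxE; apply: eq_bigr => j _; rewrite mxE.
have a_ge0 : 0 <= a 0 i.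
  rewrite -(ler0z R) aiE sumr_ge0// => j _.
  by rewrite mulr_ge0//; case/andP: (s01 j).
have a_le1 : a 0 i <= 1.
  rewrite -(lerz1 R) aiE -c1 ler_sum// => j _.
  by rewrite ler_piMr//; case/andP: (s01 j).
by lia.
Qed.

(** A line contains at most two points with coordinates 0 or 1, and the difference
    of two such points has an entry 1 or -1. So the dual cell is the segment joining
    the only two maximal exponents, and it is primitive. *)
Lemma dual_segment_hyperplane :
  weight (hypersurface p) (cell_at p x) = 1 /\
  exists w, dual_cell p (cell_at p x) = @segment R n w (w + nu).
Proof.
have [[a [b [ab ax bx]]] xline] := edge_nu.
have a01 := hyperplane_exponent ax.1; have b01 := hyperplane_exponent bx.1.
have [i abi] : exists i, b 0 i != a 0 i.
  have /rV0Pn[i] : b - a != 0 by rewrite subr_eq0 eq_sym.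
  by rewrite !mxE subr_eq0; exists i.
have ba1 : Defs.content (b - a) = 1%N.
  apply/eqP; rewrite -dvdn1; apply: dvdn_trans (content_dvd _ i) _.
  by rewrite !mxE; move: abi; case: (a01 i) => ->; case: (b01 i) => ->.
have abE : dual_cell p (cell_at p x) = @segment R n a b.
  rewrite dual_cell_at /segment; congr conv_hull; apply/seteqP; split; last first.
    by move=> _ [->|->]; [exists a|exists b].
  move=> _ [c cx <-].
  have [s sE] := xline _ _ bx ax; have [t tE] := xline _ _ cx ax.
  have [s0 _] : s != 0 /\ to_real R nu != 0.
    by apply: multiple_neq0 sE; rewrite eq_sym.
  have c01 := hyperplane_exponent cx.1.
  have caE : to_real R (c - a) = (t / s) *: to_real R (b - a).
    by rewrite sE scalerA divfK.
  (* Collinearity of a, b, c, cleared of denominators. The coordinate i, on which a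
     and b differ, decides which of them c is. *)
  have cab j : (c 0 j - a 0 j) * (b 0 i - a 0 i) =
      (c 0 i - a 0 i) * (b 0 j - a 0 j).
    apply: (@intr_inj R); rewrite !rmorphM/=.
    have := congr1 (fun w : 'rV[R]_n => w 0 i) caE.
    have := congr1 (fun w : 'rV[R]_n => w 0 j) caE.
    by rewrite !mxE => -> ->; ring.
  have [ca|cb] : c 0 i = a 0 i \/ c 0 i = b 0 i.
    move: abi; case: (a01 i) => ->; case: (b01 i) => -> // _; case: (c01 i) => ->;
      by [left|right].
  - left; congr to_real; apply/rowP => j; have := cab j.
    rewrite ca subrr mul0r => /eqP; rewrite mulf_eq0 !subr_eq0 (negPf abi) orbF.
    by move/eqP.
  - right; congr to_real; apply/rowP => j; have := cab j.
    rewrite cb [RHS]mulrC => /mulIf; rewrite subr_eq0 => /(_ abi).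
    by move/addIr.
split; last exact: primitive_segment ba1 abE.
by rewrite /= abE lattice_length_segment ba1.
Qed.

End DualSegments.

Section TransverseFacets.
Variables (R : realType) (n : nat) (p : tpoly R n) (x : 'rV[R]_n).

(** The point lies in the relative interior of g, hence in no other cell: h, which
    is only known to contain x, is g. *)
Lemma transverse_facet g h (nu : 'rV[int]_n) :
  facet (hypersurface p) g -> relint g x ->
  facet (hypersurface p) h -> h x -> primitive_normal h nu ->
  h = cell_at p x /\ edge_at p x (to_real R nu).
Proof.
move=> gfacet gx hfacet hx; have [d xd] := facet_edge gfacet gx.
have -> : h = cell_at p x.
  by apply: (sole_cell_facet h (sole_cell_at xd) (relint_cell_at p x)).1.
move=> nuP; split=> //; apply: (edge_at_normal xd nuP).
by apply: contraPneq nuP.1 => ->; rewrite content0.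
Qed.

Lemma edge_at_parallel (d d' : 'rV[R]_n) : edge_at p x d -> edge_at p x d' ->
  exists t : R, d' = t *: d.
Proof.
move=> [[a [b [ab ax bx]]] xd] [_ xd'].
have [t tE] := xd _ _ ax bx; have [t' t'E] := xd' _ _ ax bx.
have [t'0 _] := multiple_neq0 ab t'E.
by exists (t / t'); rewrite mulrC -scalerA -tE t'E scalerA mulVf ?scale1r.
Qed.

End TransverseFacets.

(** * Volume of a sum of lattice segments *)

Section Volume.
Variables (R : realType) (n : nat).

Lemma row_mulmxE (W : 'M[int]_n) (t : 'I_n -> R) :
  (\row_i t i) *m map_mx intr W = \sum_i t i *: to_real R (row i W).
Proof.
apply/rowP => j; rewrite mxE summxE; apply: eq_bigr => i _.
by rewrite !mxE.
Qed.

(** In the coordinates of the basis formed by the rows, the parallelotope is the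
    unit cube. *)
Lemma parallelotope_closed (W : 'M[int]_n) : \det W != 0 ->
  closed (parallelotope (R := R) W).
Proof.
move=> W0; pose V : 'M[R]_n := map_mx intr W.
have Vu : V \in unitmx by rewrite unitmxE det_map_mx unitfE intr_eq0.
pose coord i (y : 'rV[R]_n) := dot y (col i (invmx V))^T.
have coordE i y : coord i y = (y *m invmx V) 0 i.
  by rewrite mxE; apply: eq_bigr => j _; rewrite !mxE.
have -> : parallelotope (R := R) W = \bigcap_i [set y | 0 <= coord i y <= 1].
  apply/seteqP; split=> [_ [t [t01 ->]] i _ /=|y y01].
    by rewrite -row_mulmxE coordE mulmxK// mxE.
  exists (fun i => coord i y); split=> [i|]; first exact: y01.
  rewrite -row_mulmxE -/V; have -> : \row_i coord i y = y *m invmx V.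
    by apply/rowP => i; rewrite mxE coordE.
  by rewrite mulmxKV.
apply: closed_bigI => i _.
have -> : [set y | 0 <= coord i y <= 1] = coord i @^-1` `[0, 1]%classic.
  by apply/seteqP; split=> y /=; rewrite in_itv.
apply: closed_comp; last exact: interval_closed.
by move=> y _; apply: continuous_dot.
Qed.

Lemma closed_borel_measurable (D : set 'rV[R]_n) : closed D ->
  measurable (D : set (borel R n)).
Proof.
move=> Dc; rewrite -[D]setCK; apply: measurableC.
by apply: sub_sigma_algebra; apply: closed_openC.
Qed.

Lemma minkowski_segments r (F : 'I_r -> set 'rV[R]_n) (a nu : 'I_r -> 'rV[int]_n) y :
  (forall i, F i = segment (a i) (a i + nu i)) ->
  minkowski_sum F y <-> exists t : 'I_r -> R, (forall i, 0 <= t i <= 1) /\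
    y = \sum_i to_real R (a i) + \sum_i t i *: to_real R (nu i).
Proof.
move=> FE; have FP i z : F i z <-> exists t : R, 0 <= t <= 1 /\
    z = to_real R (a i) + t *: to_real R (nu i).
  rewrite FE segmentE [a i + nu i]addrC addrK.
  by split=> [[t]|[t []]]; exists t.
split=> [[f [Ff ->]]|[t [t01 ->]]].
  have /choice[t tP] i := (FP i (f i)).1 (Ff i).
  exists t; split=> [i|]; first by have [] := tP i.
  by rewrite -big_split/=; apply: eq_bigr => i _; have [_] := tP i.
exists (fun i => to_real R (a i) + t i *: to_real R (nu i)).
by split=> [i|]; [apply/FP; exists (t i)|rewrite big_split].
Qed.

End Volume.

(** The mixed cell is the translate, by the sum of the points a i and b j, of the
    parallelotope spanned by the vectors nu i and mu j. *)
Lemma volume_mixed_cell (R : realType) (r s : nat)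
    (vol : {measure set (borel R (r + s)) -> \bar R})
    (F : 'I_r -> set 'rV[R]_(r + s)) (G : 'I_s -> set 'rV[R]_(r + s))
    (a nu : 'I_r -> 'rV[int]_(r + s)) (b mu : 'I_s -> 'rV[int]_(r + s)) :
  let W := col_mx (\matrix_i nu i) (\matrix_j mu j) in
  lattice_volume vol -> \det W != 0 ->
  (forall i, F i = segment (a i) (a i + nu i)) ->
  (forall j, G j = segment (b j) (b j + mu j)) ->
  vol (set_add (minkowski_sum F) (minkowski_sum G)) = (`|\det W|%:~R)%:E.
Proof.
move=> W [vol_translate vol_det] W0 FE GE.
pose c := \sum_i to_real R (a i) + \sum_j to_real R (b j).
rewrite -vol_det -[RHS](vol_translate _ c); last first.
  by apply: closed_borel_measurable; apply: parallelotope_closed.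
have WE (t : 'I_(r + s) -> R) : \sum_k t k *: to_real R (row k W) =
    \sum_i t (lshift s i) *: to_real R (nu i) +
    \sum_j t (rshift r j) *: to_real R (mu j).
  by rewrite big_split_ord/=; congr (_ + _); apply: eq_bigr => i _;
    rewrite /W ?rowKu ?rowKd rowK.
congr (vol _); apply/seteqP; split=> [_ [y Fy [z Gz <-]]|_ [y' [t [t01 y'E]] <-]].
  have [t [t01 yE]] := (minkowski_segments y FE).1 Fy.
  have [u [u01 zE]] := (minkowski_segments z GE).1 Gz.
  pose tu (k : 'I_(r + s)) :=
    match fintype.split k with inl i => t i | inr j => u j end.
  exists (\sum_k tu k *: to_real R (row k W)).
    by exists tu; split=> // k; rewrite /tu; case: fintype.split.
  rewrite WE /c yE zE addrACA; congr ((_ + _) + (_ + _)); apply: eq_bigr => i _.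
    by rewrite /tu (unsplitK (inl i)).
  by rewrite /tu (unsplitK (inr i)).
rewrite y'E WE /c addrACA.
exists (\sum_i to_real R (a i) + \sum_i t (lshift s i) *: to_real R (nu i)).
  by apply/(minkowski_segments _ FE); exists (t \o lshift s); split=> // i; apply: t01.
exists (\sum_j to_real R (b j) + \sum_j t (rshift r j) *: to_real R (mu j)) => //.
by apply/(minkowski_segments _ GE); exists (t \o @rshift r s); split=> // j; apply: t01.
Qed.

(** * Weights of transverse complete intersections *)

(** Hypersurfaces dual at x to edges with linearly independent primitive
    directions nu i; independence is given by dual vectors, and Q, B, C1, C2 form a
    splitting of the matrix of the normals. *)
Section CompleteIntersection.
Variables (R : realType) (m b n : nat) (f : 'I_m -> tpoly R n).
Variables (x : 'rV[R]_n) (nu : 'I_m -> 'rV[int]_n).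
Let A : 'M[int]_(m, n) := \matrix_i nu i.
Variables (Q : 'M[int]_(m, n)) (B : 'M[int]_(b, n)).
Variables (C1 : 'M[int]_(n, m)) (C2 : 'M[int]_(n, b)).
Hypothesis nu1 : forall i, Defs.content (nu i) = 1%N.
Hypothesis edge_nu : forall i, edge_at (f i) x (to_real R (nu i)).
Hypothesis weight1 : forall i, weight (hypersurface (f i)) (cell_at (f i) x) = 1.
Hypothesis dual_nu : forall i, exists u : 'rV[R]_n,
  forall j, dot u (to_real R (nu j)) = (i == j)%:R.
Hypothesis CQB : C1 *m Q + C2 *m B = 1%:M.
Hypothesis AB0 : A *m B^T = 0.
Hypothesis trigT : is_trig_mx (A *m Q^T).
Hypothesis diagT : forall i, (A *m Q^T) i i != 0.

Let A_E (z : 'rV[int]_n) i : dot (to_real R z) (to_real R (nu i)) =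
  ((A *m z^T) i 0)%:~R.
Proof.
rewrite mxE rmorph_sum; apply: eq_bigr => j _.
by rewrite !mxE rmorphM/= mulrC.
Qed.

(** Prefixes of the iterated stable intersection, on which the induction runs. *)
Definition partial_inter k : complex R n :=
  stable_inters [seq hypersurface (f i) | i <- take k (enum 'I_m)].

Definition partial_cell k : set 'rV[R]_n :=
  [set y | forall i : 'I_m, (i < k)%N -> cell_at (f i) x y].

Lemma partial_cellS (i : 'I_m) :
  partial_cell i.+1 = partial_cell i `&` cell_at (f i) x.
Proof.
apply/seteqP; split=> [y yx|y [yi iy] j].
  by split=> [j ji|]; apply: yx => //; rewrite ltnS ltnW.
by rewrite ltnS leq_eqVlt => /orP[/eqP/val_inj -> //|]; apply: yi.
Qed.

Lemma partial_interS (i : 'I_m) : partial_inter i.+1 =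
  if i == 0%N :> nat then hypersurface (f i)
  else stable_inter (partial_inter i) (hypersurface (f i)).
Proof.
rewrite /partial_inter (take_nth i) ?size_enum_ord// map_rcons nth_ord_enum.
have : (size (take i (enum 'I_m)) == 0%N) = (i == 0%N :> nat).
  by rewrite size_takel// size_enum_ord ltnW.
case: take => [|j l] /= <- //; rewrite -cats1 foldl_cat /=.
by [].
Qed.

(** Induction on the number of hypersurfaces. Adding the hypersurface i multiplies
    the weight by the index of K + ker nu_i, with K the common kernel of the
    preceding normals, that is by the i-th diagonal entry of the triangular matrix. *)
Lemma partial_inter_cell k : (k <= m)%N ->
  [/\ sole_cell (partial_inter k) (partial_cell k), relint (partial_cell k) x,
    direction (partial_cell k) =
      [set u | forall i : 'I_m, (i < k)%N -> dot u (to_real R (nu i)) = 0]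
    & weight (partial_inter k) (partial_cell k) =
      \prod_(i < m | (i < k)%N) `|(A *m Q^T) i i|].
Proof.
elim: k => [|k IHk] km.
  have cell0 : partial_cell 0 = setT by apply/seteqP; split.
  have dir0 : direction [set: 'rV[R]_n] = setT.
    by apply/seteqP; split=> // u _; rewrite -[u]subr0; apply: direction_sub.
  rewrite cell0 dir0 /partial_inter take0; split.
  - by split.
  - by split=> //; apply: (filterE (F := nbhs x)).
  - by apply/seteqP; split=> // u _ i; rewrite ltn0.
  - by rewrite big_pred0.
have [gA gx gdir gw] := IHk (ltnW km).
pose i := Ordinal km; have := partial_cellS i; rewrite /= => ->.
have hB := sole_cell_at (edge_nu i); have hx := relint_cell_at (f i) x.
have hdir := direction_cell_at (edge_nu i).
have gh_dir := direction_setI gx hx.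
have ghx : relint (partial_cell k `&` cell_at (f i) x) x by apply: relintI_sup.
have gh : complementary (partial_cell k) (cell_at (f i) x).
  move=> v; have [u uE] := dual_nu i.
  pose c := dot v (to_real R (nu i)).
  exists (c *: u), (c *: u - v); split; last by rewrite opprB addrCA subrr addr0.
    rewrite gdir => j jk /=; rewrite dotZl uE -val_eqE/= gtn_eqF// mulr0.
    by [].
  by rewrite hdir /= dotBl dotZl uE eqxx mulr1 subrr.
have indexE : lattice_index
    (set_add (sublattice (partial_cell k)) (sublattice (cell_at (f i) x))) =
    absz ((A *m Q^T) i i).
  rewrite -(lattice_index_step CQB AB0 trigT diagT (k := i)); last first.
    have [z zE] := primitive_unimodular (nu1 i); exists z.
    have /matrixP/(_ 0 0) := zE; rewrite !mxE eqxx => zE1.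
    by rewrite -[RHS]zE1; apply: eq_bigr => j _; rewrite !mxE.
  congr (lattice_index (set_add _ _)); apply/seteqP; split=> z.
  - rewrite /sublattice /= -/(direction _) gdir => zA j ji.
    by apply/eqP; rewrite -(intr_eq0 R) -A_E zA.
  - rewrite /sublattice /= -/(direction _) gdir => zA j ji.
    by rewrite /= A_E zA.
  - rewrite /sublattice /= -/(direction _) hdir /= A_E => /eqP.
    by rewrite intr_eq0 => /eqP.
  - by rewrite /sublattice /= -/(direction _) hdir /= A_E => ->.
have prodE : \prod_(j < m | (j < k.+1)%N) `|(A *m Q^T) j j| =
    `|(A *m Q^T) i i| * \prod_(j < m | (j < k)%N) `|(A *m Q^T) j j|.
  rewrite (bigD1 i)//=; congr (_ * _); apply: eq_bigl => j.
  by rewrite -val_eqE /= ltnS ltn_neqAle andbC.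
split=> //.
- rewrite (partial_interS i)/=; case: eqP => [k0|_].
    suff -> : partial_cell k = setT by rewrite setTI.
    by apply/seteqP; split=> // y _ j; rewrite k0.
  exact: (sole_cell_stable_inter gA hB gh gx hx).
- rewrite gh_dir gdir hdir; apply/seteqP; split=> u.
    move=> [uk ui] j; rewrite ltnS leq_eqVlt => /orP[/eqP jk|]; last exact: uk.
    by have -> : j = i by apply: val_inj.
  by move=> uk; split=> [j jk|]; apply: uk => //; rewrite ltnS ltnW.
(* The first hypersurface is not intersected with anything; its factor in the
   product is the index of Z^n in itself. *)
rewrite (partial_interS i) /= prodE -abszE -indexE; case: eqP => [k0|_].
  have cellk : partial_cell k = setT.
    by apply/seteqP; split=> // y _ j; rewrite k0.
  rewrite {1}cellk setTI weight1 big_pred0 ?mulr1; last by move=> j; rewrite k0.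
  suff -> : set_add (sublattice (partial_cell k)) (sublattice (cell_at (f i) x))
      = setT by rewrite lattice_index_setT.
  apply/seteqP; split=> // z _; exists z.
    rewrite /sublattice /= -/(direction _) cellk -[to_real R z]subr0.
    exact: direction_sub.
  exists 0; last by rewrite addr0.
  rewrite /sublattice /= -/(direction _) hdir /=.
  have -> : to_real R (0 : 'rV[int]_n) = 0 by apply/rowP => j; rewrite !mxE.
  exact: dot0l.
rewrite (stable_inter_weight gA hB gh).
- by rewrite gw weight1 mulr1 mulrC.
- by exists x.
- by [].
- case: gA hB => _ gc _ _ [_ hc _ _].
  by rewrite (relint_setI gc hc gx hx).
Qed.

Lemma complete_inter_cell : exists g : set 'rV[R]_n,
  [/\ sole_cell (complete_inter f) g, relint g x,
    direction g = [set u | forall i, dot u (to_real R (nu i)) = 0],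
    sublattice g = [set z | A *m z^T = 0]
    & weight (complete_inter f) g = `|\det (A *m Q^T)|].
Proof.
have [gA gx gdir gw] := partial_inter_cell (leqnn m).
have interE : partial_inter m = complete_inter f.
  by rewrite /partial_inter take_oversize// size_enum_ord.
rewrite interE in gA gw; exists (partial_cell m).
have gdir' : direction (partial_cell m) =
    [set u | forall i, dot u (to_real R (nu i)) = 0].
  by rewrite gdir; apply/seteqP; split=> u uE i; [apply: uE|move=> _; apply: uE].
split=> //.
- apply/seteqP; split=> z; rewrite /sublattice /= -/(direction _) gdir' /=.
    move=> zE; apply/colP => i; apply/eqP.
    by rewrite [X in _ == X]mxE -(intr_eq0 R) -A_E zE.
  by move=> Az i; rewrite A_E Az mxE.
- by rewrite gw det_trig// normr_prod; apply: eq_bigl => i; rewrite ltn_ord.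
Qed.

End CompleteIntersection.

(** * The multiplicity of an isolated intersection point *)

(** The affine hull of a point is that point. *)
Lemma relint_set1 (R : realType) n (x : 'rV[R]_n) : relint [set x] = [set x].
Proof.
apply/seteqP; split=> [y []//|_ ->]; split=> //.
apply: (filterE (F := nbhs x)) => z zx; apply/eqP; rewrite -subr_eq0; apply/eqP.
have : direction [set x] (z - x) by apply/aff_hullE.
apply: (lin_span_min (V := [set 0])) => //=.
- by move=> _ _ -> ->; rewrite addr0.
- by move=> c _ ->; rewrite scaler0.
- by move=> _ [_ -> [_ -> <-]]; rewrite subrr.
Qed.

(** The normals given by transversality are only known to be parallel to the rows
    of W, which does not affect independence. *)
Lemma row_free_scaled_rows (R : realType) n (W : 'M[int]_n)
    (v : 'I_n -> 'rV[R]_n) :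
  (forall k, exists t : R, v k = t *: to_real R (row k W)) ->
  row_free (\matrix_k v k) -> \det W != 0.
Proof.
move=> /choice[t tE]; rewrite row_free_unit.
have -> : \matrix_k v k = diag_mx (\row_k t k) *m map_mx intr W.
  by apply/matrixP => i j; rewrite mul_diag_mx !mxE tE !mxE.
by rewrite unitmx_mul => /andP[_]; rewrite unitmxE det_map_mx unitfE intr_eq0.
Qed.

Lemma exists_dual_basis (R : realType) n (W : 'M[int]_n) : \det W != 0 ->
  exists u : 'I_n -> 'rV[R]_n,
    forall k l, dot (u k) (to_real R (row l W)) = (k == l)%:R.
Proof.
move=> W0; pose V : 'M[R]_n := map_mx intr W.
have Vu : V \in unitmx by rewrite unitmxE det_map_mx unitfE intr_eq0.
exists (fun k => (col k (invmx V))^T) => k l.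
have := congr1 (fun M : 'M[R]_n => M l k) (mulmxV Vu); rewrite !mxE eq_sym => <-.
by apply: eq_bigr => j _; rewrite !mxE mulrC.
Qed.

Theorem theorem3p1 (R : realType) (r s : nat)
    (vol : {measure set (borel R (r + s)) -> \bar R})
    (p : 'I_r -> tpoly R (r + s)) (q : 'I_s -> tpoly R (r + s))
    (x : 'rV[R]_(r + s))
    (sigma : 'I_r -> set 'rV[R]_(r + s)) (nu : 'I_r -> 'rV[int]_(r + s))
    (tau : 'I_s -> set 'rV[R]_(r + s)) (mu : 'I_s -> 'rV[int]_(r + s)) :
  let X := complete_inter p in
  let L := complete_inter q in
  let F i := dual_cell (p i) (sigma i) in
  let G j := dual_cell (q j) (tau j) in
  let C := set_add (minkowski_sum F) (minkowski_sum G) in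
  let m := weight (stable_inter X L) [set x] in
  lattice_volume vol ->
  transverse_complete_inter p ->
  (forall j, tropical_hyperplane (q j)) ->
  generic_linear_space p q ->
  isolated (supp (stable_inter X L)) x ->
  (forall i, facet (hypersurface (p i)) (sigma i) /\ sigma i x) ->
  (forall i, primitive_normal (sigma i) (nu i)) ->
  (forall i, weight (hypersurface (p i)) (sigma i) = 1) ->
  (forall j, facet (hypersurface (q j)) (tau j) /\ tau j x) ->
  (forall j, primitive_normal (tau j) (mu j)) ->
  (m%:~R)%:E = vol C /\
  m = `|\det (col_mx (\matrix_i nu i) (\matrix_j mu j))|.
Proof.
move=> X L F G C m volP _ qhyp generic xiso sigmaP nuP sigma1 tauP muP.
pose W := col_mx (\matrix_i nu i) (\matrix_j mu j).
have [g [v [gP vP v_free]]] := generic x (isolatedS xiso).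
have pE i : sigma i = cell_at (p i) x /\ edge_at (p i) x (to_real R (nu i)).
  have [] := gP (lshift s i); rewrite (unsplitK (inl i)) => gi gix.
  by have [sf sx] := sigmaP i; apply: transverse_facet gi gix sf sx (nuP i).
have qE j : tau j = cell_at (q j) x /\ edge_at (q j) x (to_real R (mu j)).
  have [] := gP (rshift r j); rewrite (unsplitK (inr j)) => gj gjx.
  by have [sf sx] := tauP j; apply: transverse_facet gj gjx sf sx (muP j).
have W0 : \det W != 0.
  apply: row_free_scaled_rows v_free => k; rewrite /W.
  have [] := gP k; have := vP k; case: (split_ordP k) => i ->.
    rewrite rowKu rowK => vi gi gix.
    have [_ vi'] := transverse_facet gi gix gi (relint_sub gix) vi.
    exact: edge_at_parallel (pE i).2 vi'.
  rewrite rowKd rowK => vi gi gix.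
  have [_ vi'] := transverse_facet gi gix gi (relint_sub gix) vi.
  exact: edge_at_parallel (qE i).2 vi'.
(* The basis dual to all the normals witnesses the independence of the nu i, that
   of the mu j, and the complementarity of the two cells. *)
have [w wE] := exists_dual_basis R W0.
have wp (i : 'I_r) k : dot (w k) (to_real R (nu i)) = (k == lshift s i)%:R.
  by rewrite -wE /W rowKu rowK.
have wq (j : 'I_s) k : dot (w k) (to_real R (mu j)) = (k == rshift r j)%:R.
  by rewrite -wE /W rowKd rowK.
have dual_p (i : 'I_r) : exists u : 'rV[R]_(r + s),
    forall j, dot u (to_real R (nu j)) = (i == j)%:R.
  by exists (w (lshift s i)) => j; rewrite wp eq_lshift.
have dual_q (i : 'I_s) : exists u : 'rV[R]_(r + s),
    forall j, dot u (to_real R (mu j)) = (i == j)%:R.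
  by exists (w (rshift r i)) => j; rewrite wq eq_rshift.
have [Q [B [C1 [C2 [CQB AB0 trigT]]]]] :=
  exists_lattice_splitting (\matrix_i nu i) (erefl (r + s)%N).
have [Q' [B' [C1' [C2' [CQB' AB0' trigT']]]]] :=
  exists_lattice_splitting (\matrix_j mu j) (addnC r s).
have sqE := dual_segment_hyperplane _ (qE _).2 (qhyp _).
have [gX [gA gx gdir glat gw]] := complete_inter_cell
  (fun i => (nuP i).1) (fun i => (pE i).2)
  (fun i => etrans (congr1 _ (esym (pE i).1)) (sigma1 i))
  dual_p CQB AB0 trigT (splitting_diag_neq0 CQB AB0 trigT W0).
have [gL [hB hx hdir hlat hw]] := complete_inter_cell
  (fun i => (muP i).1) (fun i => (qE i).2)
  (fun j => (sqE j (muP j).1).1)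
  dual_q CQB' AB0' trigT' (splitting_diag_neq0' CQB' AB0' trigT' W0).
have gh : complementary gX gL.
  move=> y; pose u := \sum_j dot y (to_real R (mu j)) *: w (rshift r j).
  have dot_u a : dot u a = \sum_j dot y (to_real R (mu j)) * dot (w (rshift r j)) a.
    rewrite (big_morph (fun z => dot z a) (fun y z => dotDl y z a) (dot0l a)).
    by apply: eq_bigr => j _; rewrite dotZl.
  exists u, (u - y); split; last by rewrite opprB addrCA subrr addr0.
    rewrite gdir => i /=; rewrite dot_u big1// => j _.
    by rewrite wp eq_rlshift mulr0.
  rewrite hdir => j /=; rewrite dotBl dot_u (bigD1 j)//= big1.
    by rewrite wq eqxx mulr1 addr0 subrr.
  by move=> k kj; rewrite wq eq_rshift (negPf kj) mulr0.
have mE : m = `|\det W|.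
  rewrite /m (stable_inter_weight gA hB gh); first last.
  - by rewrite relint_set1 => _ ->.
  - by move=> _ ->; split; apply: relint_sub.
  - by exists x; rewrite relint_set1.
  rewrite gw hw glat hlat -!abszE (absz_det_col_mx CQB AB0 trigT CQB' AB0' trigT' W0).
  by rewrite !PoszM.
split=> //; rewrite mE.
have /choice[a aE] i : exists a, F i = segment a (a + nu i).
  rewrite /F (pE i).1; apply: dual_segment_weight1 (nuP i).1 (pE i).2 _.
  by rewrite -(pE i).1.
have /choice[b bE] j : exists b, G j = segment b (b + mu j).
  by rewrite /G (qE j).1; have [] := sqE j (muP j).1.
by rewrite (volume_mixed_cell volP W0 aE bE).
Qed.
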